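(* Let $D>0$ and let $(\Gamma_n,S_n)_{n\in\mathbb{N}}$ be a sequence of abelian Cayley graphs (that is, each $\Gamma_n$ is abelian) such that $|S_n^n|\ll n^D|S_n|$ (that is, there is a constant $C$ with $|S_n^n|\le Cn^D|S_n|$ for all $n$). Then for every sequence $(m_n)$ of positive numbers with $m_n\gg n$ (that is, $m_n\ge cn$ for all $n$, for some constant $c>0$) the sequence $(\Gamma_n,\frac{d_{S_n}}{m_n})$ is GH-relatively compact, and every cluster point is (isometric to) a connected abelian Lie group of dimension at most $D$ equipped with an invariant Finsler metric.
   Context: A Cayley graph $(\Gamma,S)$ means a group $\Gamma$ with a finite symmetric generating set $S$; $d_S$ is the word metric on $\Gamma$, and $S^n=\{s_1\cdots s_n:s_i\in S\}$. The metric spaces $(\Gamma_n,d_{S_n}/m_n)$ are pointed at the identity. GH-convergence: a sequence of compact metric spaces $Y_n$ GH-converges to a compact metric space $Y$ if the $Y_n$ have bounded diameter and there are maps $\phi_n:Y_n\to Y$ such that for every $\varepsilon>0$, for all $n$ large enough, every point of $Y$ is within $\varepsilon$ of $\phi_n(Y_n)$ and $(1-\varepsilon)d(x,y)-\varepsilon\le d(\phi_n(x),\phi_n(y))\le(1+\varepsilon)d(x,y)+\varepsilon$ for all $x,y\in Y_n$. A sequence of locally compact pointed metric spaces $(X_n,o_n)$ GH-converges to the locally compact pointed metric space $(X,o)$ if for every $R>0$ the balls $B(o_n,R)$ GH-converge to $B(o,R)$. A sequence is GH-relatively compact if every subsequence has a GH-convergent further subsequence; the limits of GH-convergent subsequences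 are called cluster points. An invariant Finsler metric on a connected abelian Lie group $A$ with Lie algebra $\mathfrak a$ is the length metric induced by a norm $\|\cdot\|$ on $\mathfrak a$: the distance between two points is the infimum of $\int_0^1\|\gamma(t)^{-1}\gamma'(t)\|\,dt$ over piecewise smooth paths $\gamma$ joining them. *)

(* Defs.v *)
From HB Require Import structures.
From mathcomp Require Import all_boot all_order all_algebra finmap.
From mathcomp Require Import all_classical all_reals all_analysis.

Set Implicit Arguments.
Unset Strict Implicit.
Unset Printing Implicit Defensive.

Import Order.TTheory GRing.Theory Num.Theory.
Import numFieldNormedType.Exports.

Local Open Scope classical_set_scope.
Local Open Scope fset_scope.
Local Open Scope ring_scope.

(** ** Abelian Cayley graphs, written additively *)

(* [sumset S n] is the set of sums of exactly [n] elements of [S],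
   i.e. S^n in multiplicative notation. *)
Definition sumset (G : zmodType) (S : {fset G}) (n : nat) : {fset G} :=
  iter n (fun T : {fset G} => [fset x + y | x in S, y in T]) [fset 0].

Record abelianCayleyGraph := AbelianCayleyGraph {
  cayley_group :> zmodType;
  gens : {fset cayley_group};
  gens_sym : forall s, s \in gens -> - s \in gens;
  (* the only subgroup containing [gens] is the whole group *)
  gens_generate : forall H : {pred cayley_group},
    zmod_closed H -> {subset gens <= H} -> H =i predT }.

Section SumsetTheory.
Context (G : zmodType) (S : {fset G}).

Lemma sumsetS n x : x \in sumset S n.+1 <->
  exists s y, [/\ s \in S, y \in sumset S n & x = s + y].
Proof.
split; first by move=> /imfset2P[s sS [y yS ->]]; exists s, y.
by move=> [s [y [sS yS ->]]]; apply/imfset2P; exists s => //; exists y.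
Qed.

Lemma sumset0 x : (x \in sumset S 0) = (x == 0).
Proof. by rewrite /sumset /= inE. Qed.

Lemma sumsetD m n x y :
  x \in sumset S m -> y \in sumset S n -> x + y \in sumset S (m + n)%N.
Proof.
elim: m x => [|m IHm] x; first by rewrite sumset0 => /eqP ->; rewrite add0r.
move=> /sumsetS[s [z [sS zS ->]]] yS; apply/sumsetS.
by exists s, (z + y); split => //; [exact: IHm | by rewrite addrA].
Qed.

Lemma sumsetN n x : (forall s, s \in S -> - s \in S) ->
  x \in sumset S n -> - x \in sumset S n.
Proof.
move=> symS; elim: n x => [|n IHn] x.
  by rewrite !sumset0 => /eqP ->; rewrite oppr0.
move=> /sumsetS[s [y [sS yS ->]]]; apply/sumsetS.
by exists (- s), (- y); split; [exact: symS | exact: IHn | by rewrite opprD].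
Qed.

End SumsetTheory.

Section WordMetric.
Context (G : abelianCayleyGraph).

Lemma word_exists (x : G) : exists n, x \in sumset (gens G) n.
Proof.
pose H := [pred x : G | `[< exists n, x \in sumset (gens G) n >]].
suff HT : H =i predT by apply/asboolP; have := HT x; rewrite -topredE.
apply: gens_generate => [|s sS].
  split; first by rewrite inE; exists 0%N; rewrite sumset0.
  move=> y z; rewrite !inE => -[m ym] [n zn].
  exists (m + n)%N; apply: sumsetD => //.
  by apply: sumsetN zn; exact: gens_sym.
rewrite inE; exists 1%N; apply/sumsetS.
by exists s, 0; split; rewrite ?sumset0 ?addr0.
Qed.

Definition word_dist (x y : G) : nat := ex_minn (word_exists (y - x)).

Lemma word_distxx x : word_dist x x = 0%N.
Proof.
rewrite /word_dist; case: ex_minnP => n _ /(_ 0%N).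
by rewrite subrr sumset0 eqxx leqn0 => /(_ isT)/eqP.
Qed.

Lemma word_dist_eq0 x y : word_dist x y = 0%N -> x = y.
Proof.
rewrite /word_dist; case: ex_minnP => n nP _ n0; move: nP.
by rewrite n0 sumset0 subr_eq0 => /eqP ->.
Qed.

Lemma word_dist_sym x y : word_dist x y = word_dist y x.
Proof.
suff le_sym u v : (word_dist u v <= word_dist v u)%N.
  by apply/eqP; rewrite eqn_leq !le_sym.
rewrite /word_dist; case: ex_minnP => m _ mmin; case: ex_minnP => n nP _.
apply: mmin; rewrite -opprB; apply: sumsetN nP; exact: gens_sym.
Qed.

Lemma word_dist_triangle y x z :
  (word_dist x z <= word_dist x y + word_dist y z)%N.
Proof.
rewrite /word_dist; case: ex_minnP => m _ mmin.
case: ex_minnP => n nP _; case: ex_minnP => p pP _; apply: mmin.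
by rewrite addnC -(subrK y z) -addrA; exact: sumsetD.
Qed.

End WordMetric.

(* The metric space (G, d_S / m). *)
Definition rescaled (R : realType) (m : {posnum R}) (G : abelianCayleyGraph)
  : Type := G.

Section Rescaled.
Context (R : realType) (m : {posnum R}) (G : abelianCayleyGraph).

HB.instance Definition _ := Choice.on (rescaled m G).

Definition rescaled_dist (x y : rescaled m G) : R :=
  (@word_dist G x y)%:R / m%:num.

Lemma rescaled_distxx x : rescaled_dist x x = 0.
Proof. by rewrite /rescaled_dist word_distxx mul0r. Qed.

Lemma rescaled_dist_eq0 x y : rescaled_dist x y = 0 -> x = y.
Proof.
move/eqP; rewrite /rescaled_dist mulf_eq0 invr_eq0 pnatr_eq0.
by case/orP=> /eqP; [exact: (@word_dist_eq0 G) | move/eqP; rewrite gt_eqF].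
Qed.

Lemma rescaled_dist_sym x y : rescaled_dist x y = rescaled_dist y x.
Proof. by rewrite /rescaled_dist word_dist_sym. Qed.

Lemma rescaled_dist_triangle y x z :
  rescaled_dist x z <= rescaled_dist x y + rescaled_dist y z.
Proof.
by rewrite /rescaled_dist -mulrDl ler_pM2r// -natrD ler_nat word_dist_triangle.
Qed.

HB.instance Definition _ := @isMetric.Build R (rescaled m G) rescaled_dist
  rescaled_distxx rescaled_dist_eq0 rescaled_dist_sym rescaled_dist_triangle.

End Rescaled.

(** ** Gromov-Hausdorff convergence *)

Section GromovHausdorff.
Context (R : realType).

(* Convergence of the compact metric spaces [A n], given as subsets of ambient
   metric spaces [Y n], to the compact metric space [B], a subset of [Z].  The
   values of [phi n] outside [A n] are irrelevant. *)
Definition GH_cvg_compact (Y : nat -> metricType R) (A : forall n, set (Y n))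
    (Z : metricType R) (B : set Z) : Prop :=
  [/\ forall n, compact (A n),
      compact B,
      exists M : R, forall n x y, A n x -> A n y -> mdist x y <= M &
      exists phi : forall n, Y n -> Z,
        (forall n x, A n x -> B (phi n x)) /\
        forall e : R, 0 < e -> \forall n \near \oo,
          (forall z, B z -> exists2 x, A n x & mdist z (phi n x) <= e) /\
          (forall x y, A n x -> A n y ->
            (1 - e) * mdist x y - e <= mdist (phi n x) (phi n y)
              <= (1 + e) * mdist x y + e)].

(* [closed_ball] of the library is the closure of the open ball, which may be
   smaller. *)
Definition mball (X : metricType R) (x : X) (r : R) : set X :=
  [set y | mdist x y <= r].

Definition GH_cvg (X : nat -> metricType R) (o : forall n, X n)
    (Z : metricType R) (z : Z) : Prop :=
  forall r : R, 0 < r -> GH_cvg_compact (fun n => mball (o n) r) (mball z r).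

Definition GH_relatively_compact (X : nat -> metricType R)
    (o : forall n, X n) : Prop :=
  forall u : nat -> nat, {homo u : i j / (i < j)%N} ->
    exists2 v : nat -> nat, {homo v : i j / (i < j)%N} &
      exists (Z : metricType R) (z : Z), GH_cvg (fun n => o (u (v n))) z.

Definition GH_cluster_point (X : nat -> metricType R) (o : forall n, X n)
    (Z : metricType R) (z : Z) : Prop :=
  exists2 u : nat -> nat, {homo u : i j / (i < j)%N} &
    GH_cvg (fun n => o (u n)) z.

End GromovHausdorff.

(** ** Abelian Lie groups and invariant Finsler metrics *)

Section Smooth.
Context (R : realType).

(* [U] is meant to be open. *)
Fixpoint Cn_on (V W : normedModType R) (k : nat) (U : set V) (f : V -> W)
    : Prop :=
  if k is k'.+1 then
    (forall x, U x -> differentiable f x) /\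
    (forall v : V, Cn_on k' U (fun x => 'D_v f x))
  else forall x, U x -> {for x, continuous f}.

Definition smooth_on (V W : normedModType R) (U : set V) (f : V -> W) : Prop :=
  forall k, Cn_on k U f.

(* A homeomorphism from the open set [cdom] of [A] onto the open set [cimg] of
   R^d; the values of [cmap] and [cinv] elsewhere are irrelevant. *)
Record chart (d : nat) (A : topologicalType) := Chart {
  cdom : set A;
  cimg : set 'rV[R]_d;
  cmap : A -> 'rV[R]_d;
  cinv : 'rV[R]_d -> A;
  cdom_open : open cdom;
  cimg_open : open cimg;
  cmap_img : forall x, cdom x -> cimg (cmap x);
  cinv_dom : forall u, cimg u -> cdom (cinv u);
  cmapK : forall x, cdom x -> cinv (cmap x) = x;
  cinvK : forall u, cimg u -> cmap (cinv u) = u;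
  cmap_continuous : forall x, cdom x -> {for x, continuous cmap};
  cinv_continuous : forall u, cimg u -> {for u, continuous cinv} }.

(* Real abelian Lie groups of dimension [d], written additively. *)
Record abelianLieGroup (d : nat) := AbelianLieGroup {
  lie_group :> topologicalZmodType;
  lie_hausdorff : hausdorff_space lie_group;
  lie_second_countable : @second_countable lie_group;
  atlas : set (chart d lie_group);
  atlas_cover : forall x, exists2 c, atlas c & cdom c x;
  atlas_smooth : forall c c', atlas c -> atlas c' ->
    smooth_on [set u | cimg c u /\ cdom c' (cinv c u)]
              (fun u => cmap c' (cinv c u));
  lie_add_smooth : forall c1 c2 c3, atlas c1 -> atlas c2 -> atlas c3 ->
    smooth_on [set p : 'rV[R]_d * 'rV[R]_d | [/\ cimg c1 p.1, cimg c2 p.2 &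
                 cdom c3 (cinv c1 p.1 + cinv c2 p.2)]]
              (fun p => cmap c3 (cinv c1 p.1 + cinv c2 p.2));
  lie_opp_smooth : forall c c', atlas c -> atlas c' ->
    smooth_on [set u | cimg c u /\ cdom c' (- cinv c u)]
              (fun u => cmap c' (- cinv c u)) }.

End Smooth.

Section Finsler.
Context (R : realType) (d : nat) (A : abelianLieGroup R d).

Definition is_norm (N : 'rV[R]_d -> R) : Prop :=
  [/\ forall u v, N (u + v) <= N u + N v,
      forall (a : R) u, N (a *: u) = `|a| * N u &
      forall u, N u = 0 -> u = 0].

Definition smooth_curve_at (g : R -> A) (t : R) : Prop :=
  {for t, continuous g} /\
  forall c, atlas c -> cdom c (g t) ->
    exists2 U : set R, open_nbhs t U &
      smooth_on (U : set R^o) ((fun s => cmap c (g s)) : R^o -> 'rV[R]_d).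

(* On each closed interval of some partition of [0, 1], [g] is the restriction
   of a curve which is smooth around that interval.  As consecutive intervals
   share their end point, this entails continuity of [g] on [0, 1]. *)
Definition piecewise_smooth (g : R -> A) : Prop :=
  exists2 s : seq R, itv_partition 0 1 s &
    forall i, (i < size s)%N ->
      let J := `[nth 0 (0 :: s) i, nth 0 (0 :: s) i.+1] in
      exists2 h : R -> A, {in J, forall t, smooth_curve_at h t}
                        & {in J, g =1 h}.

(* A chart [c] around 0 identifies the Lie algebra T_0 A with R^d, so norms on
   the Lie algebra are norms [N] on R^d; under this identification
   gamma(t)^-1 gamma'(t) is the derivative at s = t of s |-> c (g s - g t).
   It is undefined (and takes a default value) at finitely many [t] only. *)
Definition finsler_length (c : chart R d A) (N : 'rV[R]_d -> R) (g : R -> A)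
    : \bar R :=
  (\int[lebesgue_measure]_(t in `[0%R, 1%R])
     (N (derive1 (fun s : R => cmap c (g s - g t)%R) t))%:E)%E.

Definition finsler_dist (c : chart R d A) (N : 'rV[R]_d -> R) (x y : A)
    : \bar R :=
  ereal_inf [set finsler_length c N g | g in
    [set g | [/\ piecewise_smooth g, g 0 = x & g 1 = y]]].

(* [Z] is isometric to [A] equipped with some invariant Finsler metric. *)
Definition isometric_to_finsler (Z : metricType R) : Prop :=
  exists c N, [/\ @atlas R d A c, cdom c 0, is_norm N &
    exists2 f : Z -> A, bijective f &
      forall x y, finsler_dist c N (f x) (f y) = (mdist x y)%:E].

End Finsler.

(* Main.v *)
Require Import Defs.
From HB Require Import structures.
From mathcomp Require Import all_boot all_order all_algebra finmap.
From mathcomp Require Import all_classical all_reals all_analysis measurable_realfun.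
From mathcomp Require Import zify ring lra.

(** The limits are quotients of R^d by discrete subgroups, and they are found by
    seeing word lengths as functions of the coefficients of boundedly many
    generators.

    Choice of a scale.  Let b(j) be the size of the ball of radius j in G_n, and let
    D' be slightly larger than D.  If k maximizes b(k) / k^D' on [1, n], then
    b(jk) <= j^D' b(k) as long as jk <= n, and k = o(n) because k^D' is at
    most of the order of n^D ([scale_selection], [sublinear_scale]).  By
    Ruzsa's covering argument a number K of elements, independent of n, covers the
    ball of radius 4k up to an error 2k ([wball_cover]).  As the group is abelian,
    their combinations with coefficients in Z^K cover the whole group up to 2k
    ([wball_combination]).

    The limit.  Since k / m_n tends to 0, the rescaled length of a combination
    becomes, along an ultrafilter, a pseudonorm p on R^K, and the convergence is
    uniform on compact sets ([limit_plen_flat], [limit_plen_unif]).  The word metric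
    is almost a length metric; in the limit, this makes p the quotient by its kernel
    of the seminorm sup_t p(tv) / t, the stable norm ([flat_inf]).  The directions
    in which the stable norm vanishes can be projected away ([flat_reduce]): p comes
    from a pseudonorm q on R^d whose stable norm N is a norm, and the kernel of q is
    then discrete.  Along a subsequence, the Cayley graphs converge to the quotient
    of R^d by this kernel ([GH_cvg_torus]), which is a connected abelian Lie group.
    Its quotient metric is the Finsler metric of N ([torus_finsler]): segments give
    one inequality, and the other one compares the distance from the origin of a
    curve with its length by real induction.

    The dimension.  The A^d integer points of a cube in R^d give elements of
    G_n which are 2k-separated and have length at most c A k, with c independent
    of A and n.  The growth at the scale k bounds their number by a multiple of
    A^D', so that d <= D' ([dimension_le]), and d <= D if no integer lies in
    ]D, D'].

    Cluster points.  Every cluster point is the limit of a subsequence which also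
    converges to such a quotient, and it remains to prove that limits are unique up
    to isometry ([GH_cvg_torus_unique]).  The maps in the definition of convergence
    are not required to respect base points, but in a torus a point that is a centre
    of a ball can be translated to 0 without changing the ball ([torus_center]). *)

Set Implicit Arguments.
Unset Strict Implicit.
Unset Printing Implicit Defensive.

Import Order.TTheory GRing.Theory Num.Theory.
Import numFieldNormedType.Exports.

Local Open Scope classical_set_scope.
Local Open Scope ring_scope.

(** * Word balls in abelian Cayley graphs *)

Section WordBalls.
Local Open Scope fset_scope.
Local Open Scope ring_scope.
Context (G : abelianCayleyGraph).
Implicit Types (x y : G) (k l m n : nat).

(** Adding 0 to the generators turns sums of exactly [n] generators into sums of
    at most [n], so that the balls are nested. *)
Definition wball n : {fset G} := sumset (0 |` gens G)%fset n.

Definition wlen x : nat := word_dist (0 : G) x.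

Lemma word_distE x y : word_dist x y = wlen (y - x).
Proof. by rewrite /wlen /word_dist subr0. Qed.

Lemma wball_le m n x : (m <= n)%N -> x \in wball m -> x \in wball n.
Proof.
move=> /subnK <-; elim: (n - m)%N => [//|p IHp] /IHp xp.
rewrite addSn; apply/sumsetS; exists 0, x.
by rewrite fset1U1 add0r.
Qed.

Lemma wball0 n : (0 : G) \in wball n.
Proof. by apply: (@wball_le 0) => //; rewrite sumset0. Qed.

Lemma wballD m n x y : x \in wball m -> y \in wball n -> x + y \in wball (m + n).
Proof. exact: sumsetD. Qed.

Lemma sumset_sub_wball n x : x \in sumset (gens G) n -> x \in wball n.
Proof.
elim: n x => [//|n IHn] x /sumsetS[s [y [sS yS ->]]].
by apply/sumsetS; exists s, y; rewrite !inE sS orbT IHn.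
Qed.

Lemma wball_sub_sumset n x : x \in wball n ->
  exists2 k, (k <= n)%N & x \in sumset (gens G) k.
Proof.
elim: n x => [|n IHn] x; first by exists 0%N.
move=> /sumsetS[s [y [+ /IHn[k kn yk] ->]]]; rewrite !inE => /orP[/eqP ->|sS].
  by exists k; [exact: leqW | rewrite add0r].
by exists k.+1 => //; apply/sumsetS; exists s, y.
Qed.

Lemma wlen_le n x : (wlen x <= n)%N = (x \in wball n).
Proof.
rewrite /wlen /word_dist subr0; case: ex_minnP => k xk kmin.
apply/idP/idP => [kn|/wball_sub_sumset[l ln /kmin kl]]; last exact: leq_trans ln.
exact: wball_le kn (sumset_sub_wball xk).
Qed.

Lemma wlen0 : wlen (0 : G) = 0%N.
Proof. by apply/eqP; rewrite -leqn0 wlen_le wball0. Qed.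

Lemma wlenD x y : (wlen (x + y) <= wlen x + wlen y)%N.
Proof. by rewrite wlen_le; apply: wballD; rewrite -wlen_le. Qed.

Lemma wlenN x : wlen (- x) = wlen x.
Proof. by rewrite {1}/wlen word_dist_sym word_distE opprK add0r. Qed.

Lemma wlenBC x y : wlen (x - y) = wlen (y - x).
Proof. by rewrite -wlenN opprB. Qed.

Lemma wlen_sum (I : Type) (r : seq I) (P : pred I) (F : I -> G) :
  (wlen (\sum_(i <- r | P i) F i) <= \sum_(i <- r | P i) wlen (F i))%N.
Proof.
elim/big_rec2: _ => [|i m x _ xm]; first by rewrite wlen0.
by apply: leq_trans (wlenD _ _) _; rewrite leq_add2l.
Qed.

Lemma wlenMn x n : (wlen (x *+ n) <= n * wlen x)%N.
Proof.
elim: n => [|n IHn]; first by rewrite mulr0n wlen0.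
by rewrite mulrS mulSn; apply: leq_trans (wlenD _ _) _; rewrite leq_add2l.
Qed.

Lemma wlenMz x (a : int) : (wlen (x *~ a) <= `|a| * wlen x)%N.
Proof.
case: a => n; first exact: wlenMn.
by rewrite NegzE mulrNz wlenN abszN; exact: wlenMn.
Qed.

(** A word can be cut anywhere, which is what makes word metrics almost
    geodesic. *)
Lemma wlen_split m n x : (wlen x <= m + n)%N ->
  exists y, (wlen y <= m)%N /\ (wlen (x - y) <= n)%N.
Proof.
rewrite wlen_le; elim: m x => [|m IHm] x.
  by rewrite add0n => xn; exists 0; rewrite wlen0 subr0 wlen_le.
rewrite addSn => /sumsetS[s [y [sS /IHm[z [zm yzn]] ->]]].
exists (s + z); split; last by rewrite opprD addrACA subrr add0r.
rewrite wlen_le; apply/sumsetS; exists s, z; split => //.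
by rewrite -/(wball m) -wlen_le.
Qed.

Lemma wball_gt0 n : (0 < #|` wball n|)%N.
Proof. by rewrite cardfs_gt0; apply/fset0Pn; exists 0; exact: wball0. Qed.

Lemma card_wball_le m n : (m <= n)%N -> (#|` wball m| <= #|` wball n|)%N.
Proof. by move=> mn; apply/fsubset_leq_card/fsubsetP => x; exact: wball_le. Qed.

(** The sets S^n may alternate between two parity classes, hence the factor 2. *)
Lemma card_wball_sumset n : (0 < n)%N -> gens G != fset0 ->
  (#|` wball n| <= 2 * #|` sumset (gens G) n|)%N.
Proof.
case: n => // n _ /fset0Pn[s sS]; pose S := sumset (gens G).
have SSS k x : x \in S k -> x \in S k.+2.
  move=> xk; apply/sumsetS; exists s, (- s + x); rewrite addNKr; split => //.
  by apply/sumsetS; exists (- s), x; split => //; exact: gens_sym.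
have sub : (wball n.+1 `<=` S n.+1 `|` S n)%fset.
  apply/fsubsetP => x /wball_sub_sumset[k kn xk]; rewrite inE.
  have [j [jk xj]] : exists j, ((j = n.+1) \/ (j = n)) /\ x \in S j.
    move: kn xk => /subnK; move: (n.+1 - k)%N => l.
    elim/ltn_ind: l k => -[|[|l]] IHl k.
    - by rewrite add0n => -> xn; exists n.+1; split => //; left.
    - by rewrite add1n => -[->] xn; exists n; split => //; right.
    - move=> kl /SSS xk; apply: (IHl l _ k.+2) => //; lia.
  by case: jk xj => -> ->; rewrite ?orbT.
apply: leq_trans (fsubset_leq_card sub) _.
have : (#|` S n| <= #|` S n.+1|)%N.
  have <- : #|` [fset (s + x)%R | x in S n]%fset| = #|` S n|.
    by rewrite card_imfset//; exact: addrI.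
  apply/fsubset_leq_card/fsubsetP => _ /imfsetP[x /= xn ->].
  by apply/sumsetS; exists s, x.
move=> SnS; rewrite cardfsU mul2n -addnn (leq_trans (leq_subr _ _))//.
by rewrite leq_add2l.
Qed.

(** Packing: the translates of the ball of radius [k] by a [2 * k]-separated
    family are disjoint. *)
Lemma card_separated k l (s : seq G) : uniq s ->
  {in s, forall x, (wlen x <= l)%N} ->
  {in s &, forall x y, (wlen (x - y) <= k + k)%N -> x = y} ->
  (size s * #|` wball k| <= #|` wball (l + k)|)%N.
Proof.
move=> us sl sk; have /= <- := size_allpairs +%R s (enum_fset (wball k)).
rewrite cardfE cardE -(size_map val); apply: uniq_leq_size => [|_ /allpairsP[[x y] /= [xs yk ->]]].
  apply: allpairs_uniq => //; first exact: fset_uniq.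
  move=> _ _ /allpairsP[[x y] /= [xs yk ->]] /allpairsP[[x' y'] /= [x's y'k ->]]; rewrite /uncurry/= => e.
  have xx' : x = x'.
    apply: sk => //; have -> : x - x' = y' + - y.
      by apply/eqP; rewrite subr_eq addrAC (addrC y') -e addrK.
    by apply: leq_trans (wlenD _ _) _; rewrite wlenN leq_add// wlen_le.
  by move: e; rewrite xx' => /addrI ->.
have xyl : x + y \in wball (l + k) by apply: wballD => //; rewrite -wlen_le sl.
by apply/mapP; exists [` xyl]%fset => //; rewrite mem_enum.
Qed.

(** Ruzsa's covering argument: by packing, a [2 * k]-separated family in the ball
    of radius [4 * k] has at most [K] elements, and a maximal one is [2 * k]-dense. *)
Lemma wball_cover k K : (#|` wball (5 * k)| <= K * #|` wball k|)%N ->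
  exists x : 'I_K -> G, (forall i, (wlen (x i) <= 4 * k)%N) /\
    forall y, (wlen y <= 4 * k)%N -> exists i, (wlen (y - x i) <= 2 * k)%N.
Proof.
move=> bK.
pose good s := [/\ uniq s, {in s, forall x, (wlen x <= 4 * k)%N} &
  {in s &, forall x y : G, (wlen (x - y) <= k + k)%N -> x = y}].
pose P n := `[< exists2 s, good s & size s = n >].
have PK n : P n -> (n <= K)%N.
  move=> /asboolP[s [us s4 sk] <-]; have := card_separated us s4 sk.
  rewrite -mulSnr => sb; have := leq_trans sb bK.
  by rewrite leq_pmul2r// wball_gt0.
have exP : exists n, P n by exists 0%N; apply/asboolP; exists [::].
case: (ex_maxnP exP PK) => n /asboolP[s [us s4 sk] ss] nmax.
have K_gt0 : (0 < K)%N.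
  apply: (@leq_trans n); last by apply: PK; apply/asboolP; exists s.
  apply: nmax; apply/asboolP; exists [:: (0 : G)] => //; split => //.
    by move=> x; rewrite inE => /eqP ->; rewrite wlen0.
  by move=> x y; rewrite !inE => /eqP -> /eqP ->.
exists (fun i => nth 0 s i); split => [i|y y4].
  have [si|si] := ltnP i (size s); first by apply: s4; exact: mem_nth.
  by rewrite nth_default// wlen0.
(* a point far from all the [x i] would enlarge the family *)
apply: contrapT => /forallNP nc.
suff : P n.+1 by move/nmax; rewrite ltnn.
have ny x : x \in s -> ~ (wlen (y - x) <= k + k)%N.
  move=> xs yx; have ix : (index x s < K)%N.
    by rewrite (leq_trans _ (PK n _)) -?ss ?index_mem//; apply/asboolP; exists s.
  by apply: (nc (Ordinal ix)); rewrite /= nth_index// mul2n -addnn.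
apply/asboolP; exists (y :: s); last by rewrite /= ss.
split => /=.
- rewrite us andbT; apply/negP => /ny; apply; by rewrite subrr wlen0.
- by move=> x; rewrite inE => /orP[/eqP ->//|/s4].
- move=> a b; rewrite !inE => /orP[/eqP ->|aS] /orP[/eqP ->|bS]//.
  + by move=> /(ny _ bS).
  + by rewrite wlenBC => /(ny _ aS).
  + exact: sk.
Qed.

(** Cut a word into pieces of length [2 * k] and approximate them one after the
    other.  The error of one piece is added to the next piece: the sum has length
    at most [4 * k], so that errors do not accumulate.  As the group is abelian,
    only the number of times that each [x i] is used matters. *)
Lemma wball_combination k K (x : 'I_K -> G) : (0 < k)%N ->
  (forall y, (wlen y <= 4 * k)%N -> exists i, (wlen (y - x i) <= 2 * k)%N) ->
  forall g, exists a : 'I_K -> nat, (\sum_i a i * (2 * k) <= wlen g)%N /\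
    (wlen (g - \sum_i x i *+ a i) <= 2 * k)%N.
Proof.
move=> k0 cov.
have main j : forall g, (wlen g <= 2 * k * j.+1)%N ->
    exists a : 'I_K -> nat, (\sum_i a i <= j)%N /\
      (wlen (g - \sum_i x i *+ a i) <= 2 * k)%N.
  elim: j => [|j IHj] g gj.
    exists (fun=> 0%N); rewrite big1// big1// subr0; split => //; lia.
  have [y [y2 gy]] : exists y, (wlen y <= 2 * k)%N /\ (wlen (g - y) <= 2 * k * j.+1)%N.
    by apply: wlen_split; lia.
  have [a [aj e]] := IHj _ gy.
  have [i ei] : exists i, (wlen (y + (g - y - \sum_i x i *+ a i) - x i) <= 2 * k)%N.
    by apply: cov; have := wlenD y (g - y - \sum_i x i *+ a i); lia.
  exists (fun i' => a i' + (i' == i))%N; split.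
    have e1 : (\sum_(i' < K) (i' == i) = 1)%N.
      by rewrite (bigD1 i)//= eqxx big1// => i' /negbTE ->.
    by rewrite big_split/= e1 addn1 ltnS.
  have -> : \sum_i0 x i0 *+ (a i0 + (i0 == i)) = \sum_i x i *+ a i + x i.
    under eq_bigr do rewrite mulrnDr.
    rewrite big_split/=; congr (_ + _); rewrite (bigD1 i)//= eqxx mulr1n.
    by rewrite big1 ?addr0// => i' /negbTE ->; rewrite mulr0n.
  by move: ei; rewrite opprD !addrA (addrC y g) addrK.
move=> g; have [a [aj e]] : exists a : 'I_K -> nat,
    (\sum_i a i <= wlen g %/ (2 * k))%N /\ (wlen (g - \sum_i x i *+ a i) <= 2 * k)%N.
  by apply: main; rewrite mulnC; apply/ltnW/ltn_ceil; lia.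
exists a; split => //; rewrite -big_distrl/=.
by apply: leq_trans (leq_divM (wlen g) (2 * k)); rewrite leq_mul2r aj orbT.
Qed.

End WordBalls.

(** * A scale with controlled growth *)

(** The maximum [k] of [b j / j ^ D'] on [1, n] works: comparing [k] with [j * k]
    gives polynomial growth of exponent [D'] above the scale [k], and comparing it
    with 1 bounds [k]. *)
Lemma scale_selection (R : realType) (b : nat -> nat) (C D D' : R) n :
  (0 < n)%N -> (0 < b 1)%N -> {homo b : i j / (i <= j)%N} -> 0 < D' ->
  (b n)%:R <= C * n%:R `^ D * (b 1%N)%:R :> R ->
  exists k, [/\ (0 < k <= n)%N,
    forall j, (0 < j)%N -> (j * k <= n)%N ->
      (b (j * k)%N)%:R <= j%:R `^ D' * (b k)%:R :> R &
    k%:R `^ D' <= C * n%:R `^ D].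
Proof.
move=> n0 b1 bmono D'0 bn.
pose f (i : 'I_n) : R := (b i.+1)%:R / i.+1%:R `^ D'.
have i0 : 'I_n by exists 0%N.
have powgt0 i : (0 < i)%N -> 0 < i%:R `^ D' :> R.
  by move=> ?; apply: powR_gt0; rewrite ltr0n.
have [k0 _ kmax] := @arg_maxP _ _ _ i0 xpredT f isT.
pose k := k0.+1.
have fk j : (0 < j <= n)%N -> (b j)%:R / j%:R `^ D' <= (b k)%:R / k%:R `^ D' :> R.
  case: j => [//|j] /= jn; exact: (kmax (Ordinal jn)).
exists k; split.
- by rewrite /k /= ltn_ord.
- move=> j j0 jkn; have := fk (j * k)%N.
  rewrite muln_gt0 j0 jkn => /(_ isT).
  rewrite ler_pdivrMr ?powgt0 ?muln_gt0 ?j0//.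
  rewrite natrM powRM// => /le_trans; apply.
  by rewrite [leLHS]mulrAC mulrA mulfK ?gt_eqF ?powgt0// mulrC.
- have := fk 1%N; rewrite n0 powR1 divr1 => /(_ isT).
  rewrite ler_pdivlMr ?powgt0// => bk.
  have {}bk : (b 1%N)%:R * k%:R `^ D' <= C * n%:R `^ D * (b 1%N)%:R.
    apply: le_trans bk _; apply: le_trans bn; rewrite ler_nat; apply: bmono.
    exact: ltn_ord.
  by move: bk; rewrite [leLHS]mulrC ler_pM2r// ltr0n.
Qed.

(** * Pseudonorms that are quotients of norms *)

Section RowNorm.
Context (R : realType).

Lemma coord_le_norm n (v : 'rV[R]_n) i : `|v 0 i| <= `|v|.
Proof.
rewrite [leRHS]/Num.norm/= mx_normrE.
exact: (@le_bigmax _ _ _ 0 (fun ij : 'I_1 * 'I_n => `|v ij.1 ij.2|) (0, i)).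
Qed.

Lemma norm_le_coord n (v : 'rV[R]_n) c :
  0 <= c -> (forall i, `|v 0 i| <= c) -> `|v| <= c.
Proof.
move=> c0 vc; rewrite [leLHS]/Num.norm/= mx_normrE.
by apply/bigmax_leP; split => // -[i j] _; rewrite ord1.
Qed.

Lemma mulmx_bounded m n (M : 'M[R]_(m, n)) :
  exists2 c : R, 0 < c & forall v : 'rV_m, `|v *m M| <= c * `|v|.
Proof.
pose c := \sum_j \sum_i `|M j i| + 1.
have c0 : 0 < c by rewrite ltr_wpDl// sumr_ge0// => j _; rewrite sumr_ge0.
exists c => // v; apply: norm_le_coord => [|i].
  by rewrite mulr_ge0// ltW.
rewrite mxE; apply: le_trans (ler_norm_sum _ _ _) _.
rewrite /c mulrDl mul1r -[leLHS]addr0 lerD// mulr_suml ler_sum// => j _.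
rewrite normrM mulrC ler_pM ?coord_le_norm//.
by rewrite (bigD1 i)//= lerDl sumr_ge0.
Qed.

Lemma compact_norm_le n (c : R) : compact [set v : 'rV[R]_n | `|v| <= c].
Proof.
apply: bounded_closed_compact.
  exists c; split; first exact: num_real.
  by move=> y cy v /= /le_trans; apply; exact: ltW.
apply: (@closed_comp _ _ (fun v : 'rV[R]_n => `|v|) [set x : R | x <= c]).
  by move=> v _; exact: norm_continuous.
exact: closed_le.
Qed.

End RowNorm.

Section FlatPseudonorm.
Context (R : realType).

(** What remains of a rescaled word length, seen as a function of the coefficients
    of a bounded number of generators, when the mesh of these coefficients tends
    to 0.  Its zero set is a closed subgroup; [flat_rep] expresses that short
    elements have small coefficients modulo this subgroup, and [flat_mid] that
    words can be cut in the middle. *)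
Record flat K (p : 'rV[R]_K -> R) (C : R) := Flat {
  flat_gt0 : 0 < C;
  flatD : forall u v, p (u + v) <= p u + p v;
  flatN : forall v, p (- v) = p v;
  flat_le : forall v, p v <= C * `|v|;
  flat_rep : forall v, exists2 w, p (v - w) = 0 & `|w| <= C * p v;
  flat_mid : forall v, exists u w, [/\ p (v - (u + w)) = 0,
    p u <= p v / 2 & p w <= p v / 2] }.

(** The norm that the pseudonorm induces on tangent vectors: by subadditivity,
    [p (t *: v) / t] is largest in the limit where [t] tends to 0. *)
Definition stable_norm K (p : 'rV[R]_K -> R) (v : 'rV[R]_K) : R :=
  sup [set p (t *: v) / t | t in [set t : R | 0 < t]].

Section Theory.
Context K (p : 'rV[R]_K -> R) (C : R) (pF : flat p C).
Local Notation N := (stable_norm p).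
Implicit Types (u v w : 'rV[R]_K) (s t : R).

Let C0 : 0 < C := flat_gt0 pF.

Lemma flat0 : p 0 = 0.
Proof.
have := flat_le pF 0; rewrite normr0 mulr0 => p0; apply/eqP; rewrite eq_le p0/=.
by have := flatD pF 0 0; rewrite addr0 -[leLHS]add0r lerD2r.
Qed.

Lemma flat_ge0 v : 0 <= p v.
Proof.
have := flatD pF v (- v); rewrite subrr flat0 (flatN pF) -mulr2n -mulr_natl.
by rewrite pmulr_rge0.
Qed.

Lemma flatBC u v : p (u - v) = p (v - u).
Proof. by rewrite -(flatN pF) opprB. Qed.

Lemma flatB_le u v : p u <= p v + p (u - v).
Proof. by have := flatD pF v (u - v); rewrite addrCA subrr addr0. Qed.

Lemma flatB_trans u v w : p (u - w) <= p (u - v) + p (v - w).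
Proof. by have := flatD pF (u - v) (v - w); rewrite addrA subrK. Qed.

Lemma flat_eq u v : p (u - v) = 0 -> p u = p v.
Proof.
move=> uv; apply/eqP; rewrite eq_le.
have := flatB_le u v; rewrite uv addr0 => ->/=.
by have := flatB_le v u; rewrite flatBC uv addr0.
Qed.

Lemma flat_lip u v : `|p u - p v| <= C * `|u - v|.
Proof.
apply: le_trans (flat_le pF (u - v)); rewrite ler_norml.
have := flatB_le u v; have := flatB_le v u; rewrite (flatBC v u); lra.
Qed.

Lemma flatMn v n : p (v *+ n) <= n%:R * p v.
Proof.
elim: n => [|n IHn]; first by rewrite mulr0n flat0 mul0r.
by rewrite mulrS -natr1 mulrDl mul1r addrC (le_trans (flatD pF _ _))// lerD.
Qed.

Let has_sup_N v : has_sup [set p (t *: v) / t | t in [set t : R | 0 < t]].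
Proof.
split; first by exists (p (1 *: v) / 1), 1 => //=.
exists (C * `|v|) => _ [t /= t0 <-]; rewrite ler_pdivrMr//.
by rewrite (le_trans (flat_le pF _))// normrZ gtr0_norm// mulrCA mulrC.
Qed.

Lemma stable_norm_ge v t : 0 <= t -> p (t *: v) <= t * N v.
Proof.
rewrite le_eqVlt => /predU1P[<-|t0]; first by rewrite scale0r mul0r flat0.
by rewrite mulrC -ler_pdivrMr//; apply: ub_le_sup; [have [] := has_sup_N v|exists t].
Qed.

Lemma stable_norm_le v c : (forall t, 0 < t -> p (t *: v) <= t * c) -> N v <= c.
Proof.
move=> pc; apply: ge_sup; first by have [] := has_sup_N v.
by move=> _ [t /= t0 <-]; rewrite ler_pdivrMr// mulrC pc.
Qed.

Lemma flat_le_stable v : p v <= N v.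
Proof. by have := stable_norm_ge v ler01; rewrite scale1r mul1r. Qed.

Lemma stable_norm_ge0 v : 0 <= N v.
Proof. exact: le_trans (flat_ge0 v) (flat_le_stable v). Qed.

Lemma stable_norm_leC v : N v <= C * `|v|.
Proof.
apply: stable_norm_le => t t0; rewrite (le_trans (flat_le pF _))//.
by rewrite normrZ gtr0_norm// mulrCA.
Qed.

Lemma stable_normD u v : N (u + v) <= N u + N v.
Proof.
apply: stable_norm_le => t t0; rewrite scalerDr mulrDr.
by rewrite (le_trans (flatD pF _ _))// lerD// stable_norm_ge// ltW.
Qed.

Lemma stable_normZ (a : R) v : N (a *: v) = `|a| * N v.
Proof.
have le_a b w : N (b *: w) <= `|b| * N w.
  apply: stable_norm_le => t t0; rewrite scalerA mulrA.
  have [b0|b0] := leP 0 b; first by rewrite ger0_norm// stable_norm_ge// mulr_ge0// ltW.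
  rewrite ltr0_norm// -(flatN pF) -scaleNr -mulrN stable_norm_ge// mulr_ge0//.
    exact: ltW.
  by rewrite oppr_ge0 ltW.
apply/eqP; rewrite eq_le le_a/=.
have [->|a0] := eqVneq a 0.
  by rewrite normr0 mul0r; exact: stable_norm_ge0.
have := le_a a^-1 (a *: v); rewrite scalerA mulVf// scale1r normfV.
by rewrite ler_pdivlMl// normr_gt0.
Qed.

Lemma stable_normN v : N (- v) = N v.
Proof. by rewrite -scaleN1r stable_normZ normrN1 mul1r. Qed.

Lemma stable_norm0 : N 0 = 0.
Proof. by rewrite -(scale0r 0) stable_normZ normr0 mul0r. Qed.

Lemma stable_norm_lip u v : N u <= N v + C * `|u - v|.
Proof.
rewrite -[in leLHS](subrK v u) addrC (le_trans (stable_normD _ _))// lerD2l.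
exact: stable_norm_leC.
Qed.

(** Fekete's argument: a vector [t *: v] with a large value of [p (t *: v) / t] is
    a multiple of [s *: v], up to a remainder of order [s], so that subadditivity
    bounds [p (s *: v) / s] from below for all small [s]. *)
Lemma stable_norm_lim v (e : R) : 0 < e ->
  exists2 s0 : R, 0 < s0 & forall s, 0 < s <= s0 -> N v <= p (s *: v) / s + e.
Proof.
move=> e0.
have [_ [t /= t0 <-] Nt] := sup_adherent (divr_gt0 e0 (ltr0Sn R 1)) (has_sup_N v).
rewrite -/(N v) in Nt.
have c0 : 0 < C * `|v| + 1 by rewrite ltr_wpDl// mulr_ge0// ltW.
exists (t * (e / 2) / (C * `|v| + 1)); first by rewrite divr_gt0// mulr_gt0// divr_gt0.
move=> s /andP[s0 st].
rewrite ler_pdivlMr// in st.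
pose q := Num.truncn (t / s).
have /andP[qt tq] : q%:R <= t / s < q.+1%:R.
  by rewrite truncn_itv// divr_ge0// ltW.
have tE : t *: v = (s *: v) *+ q + (t - s * q%:R) *: v.
  rewrite -scaler_nat scalerA -scalerDl; congr (_ *: _); ring.
rewrite ler_pdivlMr// in qt; rewrite ltr_pdivrMr// -natr1 in tq.
have p1 : p (t *: v) <= q%:R * p (s *: v) + s * (C * `|v|).
  rewrite {1}tE (le_trans (flatD pF _ _))// lerD ?flatMn//.
  rewrite (le_trans (flat_le pF _))// normrZ mulrCA ler_wpM2r//.
    by rewrite mulr_ge0// ltW.
  by rewrite ger0_norm; lra.
have p2 : q%:R * p (s *: v) <= t * (p (s *: v) / s).
  rewrite mulrCA mulrC ler_wpM2l ?flat_ge0// ler_pdivlMr//.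
have p3 : p (t *: v) / t <= p (s *: v) / s + e / 2.
  rewrite ler_pdivrMr// (le_trans p1)// mulrDl [X in _ <= X + _]mulrC lerD//.
  lra.
lra.
Qed.

(** The convergence is uniform because the unit ball is compact and both sides are
    Lipschitz with a constant that does not depend on [s]. *)
Lemma stable_norm_dini (e : R) : 0 < e ->
  exists2 s0 : R, 0 < s0 & forall s w, 0 < s <= s0 -> `|w| <= 1 ->
    N w <= p (s *: w) / s + e.
Proof.
move=> e0.
have /compact_near_coveringP ncov := @compact_norm_le R K 1.
have e3 : 0 < e / 3 by rewrite divr_gt0.
have nearN : \forall s \near 0^'+, [set v : 'rV[R]_K | `|v| <= 1] `<=`
    (fun w => N w <= p (s *: w) / s + e).
  apply: ncov => v v1; have [s0 s00 sN] := stable_norm_lim v e3.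
  near=> w s.
  have s_gt0 : 0 < s by near: s; exact: nbhs_right_gt.
  have ss0 : s <= s0 by near: s; exact: nbhs_right_le.
  have vw : C * `|v - w| <= e / 3.
    rewrite mulrC -ler_pdivlMr//; near: w.
    by apply: cvgr_dist_le => //; exact: divr_gt0.
  have := stable_norm_lip w v; rewrite distrC => Nw.
  have := sN s; rewrite s_gt0 ss0 => /(_ isT) Nv.
  have : p (s *: v) / s <= p (s *: w) / s + C * `|v - w|.
    rewrite ler_pdivrMr// mulrDl mulfVK ?gt_eqF// -lerBlDl.
    rewrite (le_trans (ler_norm _))// (le_trans (flat_lip _ _))//.
    by rewrite -scalerBr normrZ gtr0_norm// mulrCA mulrC.
  lra.
have [s0 /= s00 sN] := nearN.
exists (s0 / 2); first by rewrite divr_gt0.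
move=> s w /andP[s0' ss] w1; apply: sN => //=.
by rewrite sub0r normrN gtr0_norm//; lra.
Unshelve. all: by end_near. Qed.

(** Splitting [v] repeatedly, modulo the kernel of [p], into halves of half the
    size reduces to small vectors, for which [p] and the stable norm almost agree.
    Hence [p] is the quotient by its kernel of the stable norm. *)
Lemma flat_inf v (e : R) : 0 < e ->
  exists2 u, p (v - u) = 0 & N u <= (1 + e) * p v.
Proof.
move=> e0; have eC : 0 < e / C by rewrite divr_gt0.
have [s0 s00 sN] := stable_norm_dini eC.
pose good s := forall v, p v <= s -> exists2 u, p (v - u) = 0 & N u <= (1 + e) * s.
have good_small s : 0 < s -> C * s <= s0 -> good s.
  move=> s_gt0 ss0 {}v ps; have [w vw ws] := flat_rep pF v.
  have {}ws : `|w| <= C * s by rewrite (le_trans ws)// ler_wpM2l// ltW.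
  have Cs : 0 < C * s by rewrite mulr_gt0.
  exists w => //.
  have := sN (C * s) ((C * s)^-1 *: w); rewrite Cs ss0 => /(_ isT).
  rewrite normrZ normfV gtr0_norm// ler_pdivrMl// mulr1 ws => /(_ isT).
  rewrite scalerA divff ?gt_eqF// scale1r stable_normZ normfV gtr0_norm//.
  rewrite ler_pdivrMl// mulrDr [X in _ <= X + _]mulrC divfK ?gt_eqF// => /le_trans; apply.
  rewrite -(flat_eq vw) mulrDl mul1r lerD//.
  by rewrite (mulrC C) -mulrA (mulrCA C) divff ?gt_eqF// mulr1 mulrC.
have good_half s : good (s / 2) -> good s.
  move=> gs {}v ps; have [v1 [v2 [vv p1 p2]]] := flat_mid pF v.
  have [u1 vu1 Nu1] : exists2 u, p (v1 - u) = 0 & N u <= (1 + e) * (s / 2).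
    by apply: gs; lra.
  have [u2 vu2 Nu2] : exists2 u, p (v2 - u) = 0 & N u <= (1 + e) * (s / 2).
    by apply: gs; lra.
  exists (u1 + u2); last by rewrite (le_trans (stable_normD _ _))//; lra.
  apply/eqP; rewrite eq_le flat_ge0 andbT.
  have := flatB_trans v (v1 + v2) (u1 + u2).
  have := flatD pF (v1 - u1) (v2 - u2); rewrite opprD addrACA -opprD; lra.
have [pv0|pv0] := eqVneq (p v) 0.
  by exists 0; rewrite ?subr0// stable_norm0 pv0 mulr0.
have pv : 0 < p v by rewrite lt_neqAle eq_sym pv0 flat_ge0.
suff : good (p v) by apply.
have [n nP] : exists n : nat, C * (p v / 2 ^+ n) <= s0.
  have a0 : 0 <= C * p v / s0 by rewrite !mulr_ge0 ?invr_ge0// ltW.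
  pose n := (Num.truncn (C * p v / s0)).+1; exists n.
  rewrite mulrA ler_pdivrMr ?exprn_gt0// (mulrC s0) -ler_pdivrMr//.
  have /andP[_ /ltW] := truncn_itv a0 => /le_trans; apply.
  by rewrite -natrX ler_nat ltnW// ltn_expl.
have : good (p v / 2 ^+ n) by apply: good_small => //; rewrite divr_gt0// exprn_gt0.
elim: n {nP} => [|n IHn]; first by rewrite expr0 divr1.
by move=> gn; apply: IHn; apply: good_half; rewrite -mulrA -invfM -exprSr.
Qed.

(** Compactness of the unit sphere. *)
Lemma stable_norm_lower : (forall v, N v = 0 -> v = 0) ->
  exists2 c : R, 0 < c & forall v, c * `|v| <= N v.
Proof.
move=> Ndef; have /compact_near_coveringP ncov := @compact_norm_le R K 1.
have nearN : \forall c \near 0^'+, [set v : 'rV[R]_K | `|v| <= 1] `<=`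
    (fun w => `|w| = 1 -> c <= N w).
  apply: ncov => v v1; have [Nv0|Nv0] := eqVneq (N v) 0.
    near=> w c => w1; exfalso; move: w1; apply/eqP; rewrite lt_eqF//.
    have : `|v - w| <= 1 / 2 by near: w; apply: cvgr_dist_le => //; exact: divr_gt0.
    by rewrite (Ndef _ Nv0) sub0r normrN; lra.
  have Nv : 0 < N v by rewrite lt_neqAle eq_sym Nv0 stable_norm_ge0.
  near=> w c => _.
  have cN : c <= N v / 2 by near: c; apply: nbhs_right_le; rewrite divr_gt0.
  have vw : C * `|v - w| <= N v / 2.
    rewrite mulrC -ler_pdivlMr//; near: w.
    by apply: cvgr_dist_le => //; rewrite !divr_gt0.
  have /= := stable_norm_lip v w; lra.
have [c0 /= c00 cN] := nearN.
exists (c0 / 2); first by rewrite divr_gt0.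
move=> v; have [->|v0] := eqVneq v 0.
  by rewrite normr0 mulr0 stable_norm_ge0.
have v_gt0 : 0 < `|v| by rewrite normr_gt0.
have vn1 : `| `|v|^-1 *: v| = 1.
  by rewrite normrZ normfV normr_id mulVf// gt_eqF.
have c2 : 0 < c0 / 2 by rewrite divr_gt0.
have := cN (c0 / 2); rewrite /= sub0r normrN gtr0_norm// => /(_ _ c2).
have -> : c0 / 2 < c0 by lra.
move=> /(_ isT (`|v|^-1 *: v)); rewrite /= vn1 lexx => /(_ isT erefl).
by rewrite stable_normZ normfV normr_id ler_pdivlMl// mulrC.
Unshelve. all: by end_near. Qed.

(** A short nonzero element of the kernel would be a direction in which [p] is
    small compared with the stable norm at a small scale. *)
Lemma flat_ker_discrete : (forall v, N v = 0 -> v = 0) ->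
  exists2 r : R, 0 < r & forall v, p v = 0 -> `|v| < r -> v = 0.
Proof.
move=> /stable_norm_lower[c c0 Nc].
have [s0 s00 sN] := stable_norm_dini (divr_gt0 c0 (ltr0Sn R 1)).
exists s0 => // v pv vs0; apply: contrapT => /eqP v0.
have v_gt0 : 0 < `|v| by rewrite normr_gt0.
have := sN `|v| (`|v|^-1 *: v); rewrite v_gt0 (ltW vs0) => /(_ isT).
rewrite normrZ normfV normr_id mulVf ?gt_eqF// lexx => /(_ isT).
rewrite scalerA divff ?gt_eqF// scale1r pv mul0r add0r.
have := Nc (`|v|^-1 *: v).
rewrite normrZ normfV normr_id mulVf ?gt_eqF// mulr1; lra.
Qed.

End Theory.

(** If the stable norm of [w] vanishes then [p], which it dominates, is invariant
    under translations by multiples of [w].  Where [w] has a nonzero coordinate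
    [i], such a translation annihilates the coordinate [i], which can be forgotten. *)
Lemma flat_project K (p : 'rV[R]_K.+1 -> R) (C : R) (w : 'rV_K.+1) :
  flat p C -> stable_norm p w = 0 -> w != 0 ->
  exists (T : 'M[R]_(K.+1, K)) (I : 'M[R]_(K, K.+1)) C',
    [/\ I *m T = 1%:M, forall v, p v = p (v *m T *m I) &
        flat (fun v => p (v *m I)) C'].
Proof.
move=> pF Nw w0.
have [i wi] : exists i, w 0 i != 0.
  apply: contrapT => /forallNP wi; move/eqP: w0; apply.
  by apply/rowP => i; rewrite mxE; apply/eqP/negPn/negP/wi.
pose T : 'M[R]_(K.+1, K) := col' i (1%:M - (w 0 i)^-1 *: (delta_mx i 0 *m w)).
pose I : 'M[R]_(K, K.+1) := row' i 1%:M.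
have TE a b : T a b =
    (a == lift i b)%:R - (w 0 i)^-1 * ((a == i)%:R * w 0 (lift i b)).
  by rewrite !mxE big_ord1 !mxE eqxx andbT.
have IE a b : I a b = (lift i a == b)%:R by rewrite !mxE.
have IT : I *m T = 1%:M.
  apply/matrixP => a b; rewrite mxE (bigD1 (lift i a))//= big1 => [|j ja]; last first.
    by rewrite IE eq_sym (negbTE ja) mul0r.
  rewrite IE TE eqxx mul1r addr0 eq_sym [lift i a == i]eq_sym.
  rewrite (negbTE (neq_lift i a)) mul0r mulr0 subr0 mxE.
  by rewrite (inj_eq (@lift_inj _ i)) eq_sym.
have vT (v : 'rV_K.+1) b : (v *m T) 0 b = v 0 (lift i b) - v 0 i / w 0 i * w 0 (lift i b).
  rewrite mxE; under eq_bigr do rewrite TE mulrBr.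
  rewrite big_split/= (bigD1 (lift i b))//= eqxx mulr1 big1 => [|j' /negbTE ->]; last first.
    by rewrite mulr0.
  rewrite addr0 sumrN (bigD1 i)//= eqxx mul1r big1 => [|j' /negbTE ->]; last first.
    by rewrite mul0r !mulr0.
  by rewrite addr0 !mulrA.
have vTI v : v *m T *m I = v - (v 0 i / w 0 i) *: w.
  apply/rowP => j; rewrite mxE [RHS]mxE [X in _ + X]mxE [X in - X]mxE.
  case: (unliftP i j) => [b ->|->].
    rewrite (bigD1 b)//= vT big1 => [|b' bb']; last first.
      by rewrite IE (inj_eq (@lift_inj _ i)) (negbTE bb') mulr0.
    by rewrite IE eqxx mulr1 addr0.
  rewrite big1 => [|b _]; last by rewrite IE eq_sym (negbTE (neq_lift i b)) mulr0.
  by rewrite divfK// subrr.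
have pTI v : p v = p (v *m T *m I).
  apply: (flat_eq pF); rewrite vTI opprB addrC subrK.
  apply/eqP; rewrite eq_le (flat_ge0 pF) andbT.
  by rewrite (le_trans (flat_le_stable pF _))// (stable_normZ pF) Nw mulr0.
have pT (u : 'rV_K) v : p (u *m I - v) = p ((u - v *m T) *m I).
  by rewrite pTI [X in p (X *m I)]mulmxBl -mulmxA IT mulmx1.
have [cT cT0 Tb] := mulmx_bounded T; have [cI cI0 Ib] := mulmx_bounded I.
have C0 := flat_gt0 pF.
exists T, I, (C * (cT + cI)); split => //; split.
- by rewrite mulr_gt0// addr_gt0.
- by move=> u v; rewrite mulmxDl (flatD pF).
- by move=> v; rewrite mulNmx (flatN pF).
- move=> v; rewrite (le_trans (flat_le pF _))// -mulrA ler_pM2l//.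
  by rewrite (le_trans (Ib v))// ler_wpM2r// lerDr ltW.
- move=> v; have [u vu uC] := flat_rep pF (v *m I).
  exists (u *m T); first by rewrite -pT.
  rewrite (le_trans (Tb u))// (mulrC C) -mulrA ler_pM ?(ltW cT0)//.
  by rewrite lerDl ltW.
- move=> v; have [u1 [u2 [vu p1 p2]]] := flat_mid pF (v *m I).
  exists (u1 *m T), (u2 *m T); rewrite -!pTI; split => //.
  by rewrite -mulmxDl -pT.
Qed.

(** The degenerate directions are removed one at a time; [d] becomes the dimension
    of the limit space. *)
Lemma flat_reduce K (p : 'rV[R]_K -> R) (C : R) : flat p C ->
  exists d (T : 'M[R]_(K, d)) (I : 'M[R]_(d, K)) (q : 'rV_d -> R) C',
    [/\ I *m T = 1%:M, forall v, p v = q (v *m T), flat q C' &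
        forall v, stable_norm q v = 0 -> v = 0].
Proof.
elim: K p C => [|K IHK] p C pF.
  exists 0%N, 1%:M, 1%:M, p, C; split => //; first by rewrite mulmx1.
    by move=> v; rewrite mulmx1.
  by move=> v _; apply/rowP => -[].
have [Ndef|/existsNP[w /not_implyP[Nw /eqP w0]]] :=
  pselect (forall v, stable_norm p v = 0 -> v = 0).
  exists K.+1, 1%:M, 1%:M, p, C; split => //; first by rewrite mulmx1.
  by move=> v; rewrite mulmx1.
have [T [I [C1 [IT pTI /IHK[d [T' [I' [q [C' [IT' qT' qF qN]]]]]]]]]] :=
  flat_project pF Nw w0.
exists d, (T *m T'), (I' *m I), q, C'; split => //.
  by rewrite mulmxA -(mulmxA I') IT mulmx1.
by move=> v; rewrite mulmxA -qT' -pTI.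
Qed.

End FlatPseudonorm.

(** * Ultralimits of rescaled word lengths *)

Lemma dep_choice (I : Type) (T : I -> Type) (P : forall i, T i -> Prop) :
  (forall i, exists y, P i y) -> exists y : forall i, T i, forall i, P i (y i).
Proof.
by move=> h; exists (fun i => projT1 (cid (h i))) => i; exact: (projT2 (cid (h i))).
Qed.

Section UltraLimits.
Context (F : set_system nat) (FU : UltraFilter F).

Lemma ultra_cvg (T : topologicalType) (A : set T) (f : nat -> T) :
  compact A -> (\forall i \near F, A (f i)) -> exists2 l, A l & f @ F --> l.
Proof.
move=> cA FA; have [l [Al cl]] := cA (f @ F) _ FA.
exists l => // U /= Ul.
have [//|FnU] := in_ultra_setVsetC (f @^-1` U) FU.
by have [y [nUy Uy]] := cl (~` U) U FnU Ul; case: nUy.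
Qed.

End UltraLimits.

Section LimitPseudonorm.
Context (R : realType) (G : nat -> abelianCayleyGraph) (k : nat -> nat)
  (m : nat -> R) (K : nat) (x : forall i, 'I_K -> G i).
Hypotheses (k_gt0 : forall i, (0 < k i)%N) (m_gt0 : forall i, 0 < m i)
  (x4 : forall i j, (wlen (x i j) <= 4 * k i)%N)
  (xcov : forall i (y : G i), (wlen y <= 4 * k i)%N ->
     exists j, (wlen (y - x i j) <= 2 * k i)%N).
Implicit Types (u v w : 'rV[R]_K).

(** The size of the scale [k i] after rescaling, hence the mesh of the parameters. *)
Definition mesh i : R := (k i)%:R / m i.

Definition rlen i (g : G i) : R := (wlen g)%:R / m i.

(** A real parameter [v] measures coefficients in units of the mesh, so that the
    parameter space is the same for all [i]. *)
Definition comb i v : G i := \sum_j x i j *~ Num.floor (v 0 j / mesh i).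

Definition plen i v : R := rlen (comb i v).

Lemma mesh_gt0 i : 0 < mesh i.
Proof. by rewrite divr_gt0// ltr0n. Qed.

Lemma rlen_ge0 i (g : G i) : 0 <= rlen g.
Proof. by rewrite divr_ge0// ltW. Qed.

Lemma rlenD i (g h : G i) : rlen (g + h) <= rlen g + rlen h.
Proof. by rewrite -mulrDl ler_pM2r ?invr_gt0// -natrD ler_nat wlenD. Qed.

Lemma rlenN i (g : G i) : rlen (- g) = rlen g.
Proof. by rewrite /rlen wlenN. Qed.

Lemma rlenBC i (g h : G i) : rlen (g - h) = rlen (h - g).
Proof. by rewrite -rlenN opprB. Qed.

Lemma rlenB_le i (g h : G i) : rlen g <= rlen h + rlen (g - h).
Proof. by have := rlenD h (g - h); rewrite addrCA subrr addr0. Qed.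

Lemma rlen_sum i (b : 'I_K -> int) :
  rlen (\sum_j x i j *~ b j) <= 4 * mesh i * \sum_j `|b j|%:~R.
Proof.
have -> : 4 * mesh i * \sum_j `|b j|%:~R = (\sum_j `|b j|%N * (4 * k i))%N%:R / m i.
  have -> : \sum_j `|b j|%:~R = (\sum_j `|b j|%N)%:R :> R.
    by rewrite natr_sum; apply: eq_bigr => j _; rewrite -abszE -pmulrn.
  by rewrite /mesh -big_distrl/= !natrM; ring.
rewrite ler_pM2r ?invr_gt0// ler_nat; apply: leq_trans (wlen_sum _ _ _) _.
by apply: leq_sum => j _; apply: leq_trans (wlenMz _ _) _; rewrite leq_mul2l x4 orbT.
Qed.

Lemma rlen_sum1 i (b : 'I_K -> int) : (forall j, `|b j| <= 1) ->
  rlen (\sum_j x i j *~ b j) <= 4 * K%:R * mesh i.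
Proof.
move=> b1; apply: le_trans (rlen_sum _ _) _.
rewrite mulrAC ler_pM2r ?mesh_gt0// ler_pM2l//.
apply: (@le_trans _ _ (\sum_(j < K) 1)); last by rewrite sumr_const card_ord.
by apply: ler_sum => j _; rewrite (ler_int R _ 1).
Qed.

(** Rounding errors are bounded integers and there are [K] of them. *)
Lemma combB i u v : rlen (comb i (u - v) - (comb i u - comb i v)) <= 4 * K%:R * mesh i.
Proof.
rewrite /comb -!sumrB; under eq_bigr do rewrite -!mulrzBr.
apply: rlen_sum1 => j; rewrite !mxE mulrBl.
set a := u 0 j / _; set b := v 0 j / _.
have /andP[a1 a2] := floor_itv a; have /andP[b1 b2] := floor_itv b.
have /andP[c1 c2] := floor_itv (a - b).
move: a1 a2 b1 b2 c1 c2; move: (Num.floor _) (Num.floor a) (Num.floor b) => c a' b'.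
rewrite !intrD => *.
have : (c - (a' - b'))%:~R < 1 :> R by rewrite !intrD !mulrNz; lra.
have : (-2)%:~R < (c - (a' - b'))%:~R :> R by rewrite !intrD !mulrNz; lra.
rewrite ltr_int (ltr_int R _ 1); lia.
Qed.

Lemma combD i u v : rlen (comb i (u + v) - (comb i u + comb i v)) <= 4 * K%:R * mesh i.
Proof.
have := combB i (u + v) v; rewrite addrK -rlenN opprB.
by rewrite -addrA -opprD [comb i v + _]addrC.
Qed.

Lemma comb0 i : comb i 0 = 0.
Proof. by rewrite /comb big1// => j _; rewrite mxE mul0r floor0 mulr0z. Qed.

Lemma plen_ge0 i v : 0 <= plen i v.
Proof. exact: rlen_ge0. Qed.

Lemma plen_le i v : plen i v <= 4 * K%:R * (`|v| + mesh i).
Proof.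
apply: le_trans (rlen_sum _ _) _.
have -> : 4 * K%:R * (`|v| + mesh i) = 4 * mesh i * (\sum_(j < K) (`|v| / mesh i + 1)).
  rewrite sumr_const card_ord -mulr_natl.
  have /lt0r_neq0 := mesh_gt0 i; move: (mesh i) => r r0; field; exact: r0.
apply: ler_wpM2l; first by rewrite mulr_ge0// ltW ?mesh_gt0.
apply: ler_sum => j _.
have /andP[] := floor_itv (v 0 j / mesh i).
have : `|v 0 j / mesh i| <= `|v| / mesh i.
  rewrite normrM normfV (gtr0_norm (mesh_gt0 i)) ler_pM2r ?invr_gt0 ?mesh_gt0//.
  exact: coord_le_norm.
rewrite ler_norml intr_norm intrD => /andP[] *.
by rewrite ler_norml; apply/andP; split; lra.
Qed.

Lemma plen_lip i u v : plen i u <= plen i v + 4 * K%:R * (`|u - v| + 2 * mesh i).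
Proof.
have := combB i u v; have := plen_le i (u - v).
have := rlenB_le (comb i u) (comb i v).
have := rlenB_le (comb i u - comb i v) (comb i (u - v)).
rewrite (rlenBC (_ - _) (comb _ _)) /plen; lra.
Qed.

(** The coefficients found by the covering argument cost at least one step of size
    [2 * k i] each, so that the parameter is no larger than the length. *)
Lemma comb_cover i (g : G i) : exists v,
  `|v| <= rlen g /\ rlen (g - comb i v) <= 2 * mesh i.
Proof.
have [a [ag ea]] := wball_combination (k_gt0 i) (@xcov i) g.
have meshn0 := lt0r_neq0 (mesh_gt0 i).
exists (\row_j ((a j)%:R * mesh i)); split; last first.
  rewrite /comb; under eq_bigr do rewrite mxE mulfK// (intrKfloor (Posz _)).
  rewrite /rlen /mesh mulrA ler_pM2r ?invr_gt0// -natrM ler_nat.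
  exact: ea.
apply: norm_le_coord; first exact: rlen_ge0.
move=> j; rewrite mxE ger0_norm; last by rewrite mulr_ge0// ltW// mesh_gt0.
rewrite /mesh /rlen mulrA ler_pM2r ?invr_gt0// -natrM ler_nat.
apply: leq_trans ag; rewrite (bigD1 j)//=; nia.
Qed.

Section Ultralimit.
Context (F : set_system nat) (FU : UltraFilter F).
Hypothesis meshF : mesh @ F --> (0 : R).
Notation C := (4 * K%:R : R).

Definition limit_plen v : R := lim (plen ^~ v @ F).
Local Notation p := limit_plen.

Let meshM c : (fun i => c * mesh i) @ F --> (0 : R).
Proof. by rewrite -(mulr0 c); apply: cvgM => //; exact: cvg_cst. Qed.

Lemma limit_plen_cvg v : plen ^~ v @ F --> p v.
Proof.
have [l _ fl] : exists2 l, `[0, C * (`|v| + 1)]%classic l & plen ^~ v @ F --> l.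
  apply: ultra_cvg; first exact: segment_compact.
  near=> i; rewrite /= in_itv/= plen_ge0/=.
  apply: le_trans (plen_le i v) _; rewrite ler_wpM2l ?mulr_ge0// lerD2l.
  by near: i; apply: cvgr_le meshF _ _.
by rewrite /p (cvg_lim (@Rhausdorff R) fl).
Unshelve. all: by end_near. Qed.

Arguments limit_plen_cvg v : clear implicits.

Lemma limit_plen_cvg_seq (w : nat -> 'rV[R]_K) w0 :
  w @ F --> w0 -> (fun i => plen i (w i)) @ F --> p w0.
Proof.
move=> ww0.
have dw : (fun i => C * (`|w0 - w i| + 2 * mesh i)) @ F --> (0 : R).
  have n0 : (fun i => `|w0 - w i|) @ F --> (0 : R).
    by have := cvg_norm (cvgB (cvg_cst w0) ww0); rewrite subrr normr0; exact.
  have := cvgM (cvg_cst C) (cvgD n0 (meshM 2)); rewrite addr0 mulr0; exact.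
have h1 : (fun i => plen i w0 - C * (`|w0 - w i| + 2 * mesh i)) @ F --> p w0.
  by rewrite -[p w0]subr0; apply: cvgB => //; exact: limit_plen_cvg.
have h2 : (fun i => plen i w0 + C * (`|w0 - w i| + 2 * mesh i)) @ F --> p w0.
  by rewrite -[p w0]addr0; apply: cvgD => //; exact: limit_plen_cvg.
apply: squeeze_cvgr h1 h2; near=> i.
have := plen_lip i w0 (w i); have := plen_lip i (w i) w0.
rewrite (distrC (w i)); lra.
Unshelve. all: by end_near. Qed.

Lemma limit_plen_ge0 v : 0 <= p v.
Proof.
apply: limr_ge; last by near=> i; exact: plen_ge0.
by apply/cvg_ex; exists (p v); exact: limit_plen_cvg.
Unshelve. all: by end_near. Qed.

(** The lengths are almost invariant under a change of parameters of the same group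
    element, so that such parameters are identified by [p] in the limit. *)
Lemma limit_plen_eq v (w : nat -> 'rV[R]_K) w0 c : w @ F --> w0 ->
  (\forall i \near F, rlen (comb i v - comb i (w i)) <= c * mesh i) ->
  p (v - w0) = 0.
Proof.
move=> ww0 vw; apply/eqP; rewrite eq_le limit_plen_ge0 andbT.
have vww : (fun i => v - w i) @ F --> v - w0 by apply: cvgB => //; exact: cvg_cst.
apply: (ler_cvg_to (limit_plen_cvg_seq vww) (meshM (c + C))).
near=> i; have : rlen (comb i v - comb i (w i)) <= c * mesh i by near: i.
have := combB i v (w i).
have := rlenB_le (comb i (v - w i)) (comb i v - comb i (w i)).
rewrite /plen; lra.
Unshelve. all: by end_near. Qed.

Lemma limit_plenD u v : p (u + v) <= p u + p v.
Proof.
have h : (fun i => plen i u + plen i v + C * mesh i) @ F --> p u + p v.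
  rewrite -[p u + p v]addr0; apply: cvgD; last exact: meshM.
  by apply: cvgD; exact: limit_plen_cvg.
apply: (ler_cvg_to (limit_plen_cvg (u + v)) h); near=> i.
have := combD i u v; have := rlenD (comb i u) (comb i v).
have := rlenB_le (comb i (u + v)) (comb i u + comb i v); rewrite /plen; lra.
Unshelve. all: by end_near. Qed.

Lemma limit_plenN v : p (- v) = p v.
Proof.
have le u : p (- u) <= p u.
  have h : (fun i => plen i u + C * mesh i) @ F --> p u.
    by rewrite -[p u]addr0; apply: cvgD; [exact: limit_plen_cvg|exact: meshM].
  apply: (ler_cvg_to (limit_plen_cvg (- u)) h); near=> i.
  have := combB i 0 u; have := rlenB_le (comb i (- u)) (- comb i u).
  rewrite comb0 !sub0r rlenN /plen; lra.
by apply/eqP; rewrite eq_le le/= -{1}(opprK v) le.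
Unshelve. all: by end_near. Qed.

Lemma limit_plen_le v : p v <= C * `|v|.
Proof.
have h : (fun i => C * `|v| + C * mesh i) @ F --> C * `|v|.
  by rewrite -[X in _ --> X]addr0; apply: cvgD; [exact: cvg_cst|exact: meshM].
apply: (ler_cvg_to (limit_plen_cvg v) h); near=> i.
by rewrite -mulrDr plen_le.
Unshelve. all: by end_near. Qed.

(** Parameters of bounded group elements stay in a compact set, where they converge
    along the ultrafilter. *)
Lemma limit_cover (g : forall i, G i) (l : nat -> R) l0 : l @ F --> l0 ->
  (\forall i \near F, rlen (g i) <= l i) ->
  exists (w : nat -> 'rV[R]_K) w0, [/\ w @ F --> w0, `|w0| <= l0, p w0 <= l0 &
    forall i, rlen (g i - comb i (w i)) <= 2 * mesh i].
Proof.
move=> ll0 gl; have /dep_choice[w wP] := fun i => comb_cover (g i).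
have [w0 _ ww0] : exists2 w0, [set v : 'rV[R]_K | `|v| <= l0 + 1] w0 & w @ F --> w0.
  apply: ultra_cvg; first exact: compact_norm_le.
  near=> i => /=; have [wg _] := wP i; apply: le_trans wg _.
  apply: (@le_trans _ _ (l i)); first by near: i.
  near: i; apply: cvgr_le ll0 _ _; by rewrite ltrDl.
exists w, w0; split => //.
- apply: (ler_cvg_to (cvg_norm ww0) ll0); near=> i.
  have [wg _] := wP i; apply: le_trans wg _; by near: i.
- have h : (fun i => l i + 2 * mesh i) @ F --> l0.
    by rewrite -[l0]addr0; apply: cvgD; [|exact: meshM].
  apply: (ler_cvg_to (limit_plen_cvg_seq ww0) h); near=> i.
  have gi : rlen (g i) <= l i by near: i.
  have [_] := wP i; rewrite /plen rlenBC.
  have := rlenB_le (comb i (w i)) (g i); lra.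
- by move=> i; have [] := wP i.
Unshelve. all: by end_near. Qed.

Lemma limit_plen_rep v : exists2 w, p (v - w) = 0 & `|w| <= p v.
Proof.
have [|w [w0 [ww0 w0v _ gw]]] := limit_cover (g := comb ^~ v) (limit_plen_cvg v).
  by near=> i.
by exists w0 => //; apply: (limit_plen_eq ww0 (c := 2)); near=> i; exact: gw.
Unshelve. all: by end_near. Qed.

(** Cut the words of [comb i v] in the middle and pass to the limit in the parameters
    of both halves. *)
Lemma limit_plen_mid v :
  exists u w, [/\ p (v - (u + w)) = 0, p u <= p v / 2 & p w <= p v / 2].
Proof.
pose l i := plen i v / 2 + mesh i.
have ll : l @ F --> p v / 2.
  rewrite -[p v / 2]addr0; apply: cvgD => //.
  by apply: cvgM; [exact: limit_plen_cvg|exact: cvg_cst].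
have /dep_choice[y yP] : forall i, exists y : G i, rlen y <= l i /\ rlen (comb i v - y) <= l i.
  move=> i; pose n := wlen (comb i v).
  have [y [y1 y2]] : exists y : G i, (wlen y <= uphalf n)%N /\
      (wlen (comb i v - y) <= uphalf n)%N.
    by apply: wlen_split; rewrite /n uphalf_half; lia.
  have nl : (uphalf n)%:R / m i <= l i.
    have -> : l i = (n%:R / 2 + (k i)%:R) / m i.
      by rewrite /l /plen /rlen /mesh -/n; lra.
    rewrite ler_pM2r ?invr_gt0// -(@ler_pM2r _ 2)// mulrDl divfK//.
    rewrite -!natrM -natrD ler_nat; have := k_gt0 i; rewrite uphalf_half; lia.
  exists y; split; apply: le_trans nl; by rewrite ler_pM2r ?invr_gt0// ler_nat.
have [|w1 [u1 [wu1 _ pu1 gw1]]] := limit_cover (g := y) ll.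
  by near=> i; have [] := yP i.
have [|w2 [u2 [wu2 _ pu2 gw2]]] := limit_cover (g := fun i => comb i v - y i) ll.
  by near=> i; have [] := yP i.
exists u1, u2; split => //.
apply: (limit_plen_eq (c := 4 + C) (cvgD wu1 wu2)); near=> i => /=.
have e : comb i v - comb i (w1 i + w2 i) = (y i - comb i (w1 i)) +
    (comb i v - y i - comb i (w2 i)) - (comb i (w1 i + w2 i) - (comb i (w1 i) + comb i (w2 i))).
  rewrite addrACA -opprD [X in X + _ - _]addrC subrK opprB addrA [X in _ = X - _]subrK//.
rewrite e; have := combD i (w1 i) (w2 i); have := gw1 i; have := gw2 i.
have := rlenD (y i - comb i (w1 i)) (comb i v - y i - comb i (w2 i)).
set A := _ - comb i (w1 i); set B := _ - comb i (w2 i); set D := _ - (_ + _).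
have := rlenD (A + B) (- D); rewrite rlenN; lra.
Unshelve. all: by end_near. Qed.

Lemma limit_plen_flat : flat p (C + 1).
Proof.
have C0 : 0 <= C by rewrite mulr_ge0.
split.
- by rewrite ltr_wpDl.
- exact: limit_plenD.
- exact: limit_plenN.
- move=> v; apply: le_trans (limit_plen_le v) _.
  by rewrite ler_wpM2r// lerDl.
- move=> v; have [w vw wv] := limit_plen_rep v; exists w => //.
  by rewrite (le_trans wv)// ler_peMl ?limit_plen_ge0// lerDr.
- exact: limit_plen_mid.
Qed.

(** The lengths are Lipschitz up to the mesh, with the same constant for all [i],
    so that pointwise convergence is uniform on compact sets. *)
Lemma limit_plen_unif r (e : R) : 0 < e ->
  \forall i \near F, forall v, `|v| <= r -> `|plen i v - p v| <= e.
Proof.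
move=> e0; have /compact_near_coveringP ncov := @compact_norm_le R K r.
have C1 : 0 < C + 1 by rewrite ltr_wpDl// mulr_ge0.
have e5 : 0 < e / 5 / (C + 1) by rewrite !divr_gt0.
apply: (ncov _ F (fun i v => `|plen i v - p v| <= e)) => v _.
near=> w i => /=.
have vw : `|v - w| <= e / 5 / (C + 1) by near: w; apply: cvgr_dist_le.
have mi : mesh i <= e / 5 / (C + 1) by near: i; apply: cvgr_le meshF _ e5.
have pv : `|p v - plen i v| <= e / 5.
  near: i; apply: cvgr_dist_le; [exact: limit_plen_cvg|by rewrite divr_gt0].
have : `|p v - p w| <= e / 5.
  apply: le_trans (flat_lip limit_plen_flat v w) _.
  by rewrite mulrC -ler_pdivlMr.
have : C * (`|v - w| + 2 * mesh i) <= 3 * (e / 5).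
  have m0 := mesh_gt0 i.
  apply: (@le_trans _ _ ((C + 1) * (3 * (e / 5 / (C + 1))))).
    apply: ler_pM; [exact: mulr_ge0| |by rewrite lerDl|lra].
    by rewrite addr_ge0// mulr_ge0// ltW.
  by rewrite mulrCA (mulrC (C + 1)) divfK// gt_eqF.
have := plen_lip i w v; have := plen_lip i v w; rewrite (distrC w).
move: pv; rewrite !ler_norml => /andP[] *; lra.
Unshelve. all: by end_near. Qed.

End Ultralimit.
End LimitPseudonorm.

(** * Convergent subsequences and the bound on the dimension *)

Lemma incr_ge (u : nat -> nat) : {homo u : i j / (i < j)%N} -> forall i, (i <= u i)%N.
Proof. by move=> uI; elim=> [//|i IHi]; exact: leq_ltn_trans IHi (uI _ _ _). Qed.

Lemma near_subseq (u : nat -> nat) (P : nat -> Prop) :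
  {homo u : i j / (i < j)%N} -> (\forall i \near \oo, P i) ->
  \forall i \near \oo, P (u i).
Proof.
move=> /incr_ge uI [n _ nP]; exists n => // i /= ni; apply: nP => /=.
exact: leq_trans ni (uI i).
Qed.

Lemma extract_subseq (P : nat -> nat -> Prop) :
  (forall j n, exists2 i, (n <= i)%N & P j i) ->
  exists2 u : nat -> nat, {homo u : i j / (i < j)%N} & forall j, P j (u j).
Proof.
move=> PE.
have next j n : {i | (n <= i)%N /\ P j i}.
  by apply: cid; have [i] := PE j n; exists i.
pose u := fix u j := if j is j'.+1 then sval (next j (u j').+1) else sval (next 0%N 0%N).
exists u.
  by apply: homo_ltn => [|j]; [exact: ltn_trans | case: (svalP (next j.+1 (u j).+1))].
by case=> [|j] /=; [case: (svalP (next 0%N 0%N)) | case: (svalP (next j.+1 (u j).+1))].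
Qed.

Section ParametricConvergence.
Context (R : realType) (G : nat -> abelianCayleyGraph) (k : nat -> nat)
  (m : nat -> R) (K : nat) (x : forall i, 'I_K -> G i).

Definition plen_cvg (p : 'rV[R]_K -> R) := forall (r e : R), 0 < e ->
  \forall i \near \oo, forall v : 'rV_K, `|v| <= r -> `|plen k m x i v - p v| <= e.

End ParametricConvergence.

(** Uniform convergence along an ultrafilter provides, for each [j], infinitely many
    indices where the error is at most [1 / (j + 1)] on the ball of radius [j]. *)
Theorem plen_subsequence (R : realType) (G : nat -> abelianCayleyGraph)
  (k : nat -> nat) (m : nat -> R) (K : nat) (x : forall i, 'I_K -> G i) :
  (forall i, (0 < k i)%N) -> (forall i, 0 < m i) ->
  (forall i j, (wlen (x i j) <= 4 * k i)%N) ->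
  (forall i (y : G i), (wlen y <= 4 * k i)%N ->
     exists j, (wlen (y - x i j) <= 2 * k i)%N) ->
  mesh k m @ \oo --> (0 : R) ->
  exists (p : 'rV[R]_K -> R) (C : R) (u : nat -> nat), [/\ flat p C,
    {homo u : i j / (i < j)%N} &
    plen_cvg (k \o u) (m \o u) (fun i => x (u i)) p].
Proof.
move=> k0 m0 x4 xcov mesh0.
have [F [FU Foo]] := ultraFilterLemma (T := nat) (F := \oo) _.
have meshF : mesh k m @ F --> (0 : R) by move=> A /mesh0; exact: Foo.
have pF := limit_plen_flat k0 m0 x4 xcov FU meshF.
have unif := limit_plen_unif k0 m0 x4 xcov FU meshF.
set p := limit_plen k m x F in pF unif.
pose P j i := forall v : 'rV_K, `|v| <= j%:R :> R -> `|plen k m x i v - p v| <= j.+1%:R^-1.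
have [|u uI uP] := @extract_subseq P.
  move=> j n; have j0 : 0 < j.+1%:R^-1 :> R by rewrite invr_gt0.
  have Fn : F [set i | (n <= i)%N] by apply: Foo; exists n.
  have [i [ni Pi]] := filter_ex (filterI Fn (unif j%:R _ j0)).
  by exists i.
exists p, (4 * K%:R + 1), u; split => // r e e0.
near=> i => v vr; apply: le_trans (uP i v _) _.
  apply: le_trans vr _; near: i; exact: nbhs_infty_ger.
have : e^-1 <= i%:R by near: i; exact: nbhs_infty_ger.
have e1 : 0 < e^-1 by rewrite invr_gt0.
move=> ei; rewrite -[e]invrK lef_pV2 ?posrE//.
by rewrite (le_trans ei)// ler_nat.
Unshelve. all: by end_near. Qed.

Section DimensionBound.
Context (R : realType) (G : nat -> abelianCayleyGraph) (k : nat -> nat)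
  (m : nat -> R) (K : nat) (x : forall i, 'I_K -> G i).
Hypotheses (k_gt0 : forall i, (0 < k i)%N) (m_gt0 : forall i, 0 < m i)
  (x4 : forall i j, (wlen (x i j) <= 4 * k i)%N)
  (mesh0 : mesh k m @ \oo --> (0 : R)).
Context (p : 'rV[R]_K -> R) (p_cvg : plen_cvg k m x p).
Context (d : nat) (T : 'M[R]_(K, d)) (I : 'M[R]_(d, K)) (q : 'rV[R]_d -> R) (C : R).
Hypotheses (IT : I *m T = 1%:M) (pT : forall v, p v = q (v *m T))
  (qF : flat q C) (q_def : forall v, stable_norm q v = 0 -> v = 0).

Let int_row (b : 'I_K -> int) : 'rV[R]_K := \row_j (b j)%:~R.

(** At the scale [k i] itself the limit pseudonorm gives no information.  But the
    multiple of the combination by a large integer [j] lives at a small fixed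
    fraction [t] of the scale [m i], where [p] is close to its stable norm and
    hence bounded below; the combination has at least [1 / j] times this length. *)
Lemma separated_combinations : exists2 L : R, 0 < L & forall B : R,
  \forall i \near \oo, forall b : 'I_K -> int, `|int_row b| <= B ->
    L <= `|int_row b *m T| -> (2 * k i < wlen (\sum_j x i j *~ b j)%R)%N.
Proof.
have [c c0 Nc] := stable_norm_lower qF q_def.
have [cT cT0 Tb] := mulmx_bounded T.
exists (8 / c) => [|B]; first by rewrite divr_gt0.
have c2 : 0 < c / 2 by rewrite divr_gt0.
have [s0 s00 sN] := stable_norm_dini qF c2.
pose B1 := Num.max B 1; have B10 : 0 < B1 by rewrite lt_max ltr01 orbT.
pose t := s0 / (cT * B1).
have t0 : 0 < t by rewrite divr_gt0// mulr_gt0.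
pose Cm : R := 4 * K%:R * (B1 + 2).
have Cm0 : 0 <= Cm by rewrite mulr_ge0 ?mulr_ge0// addr_ge0// ltW.
near=> i => b bB bL; set g := (\sum_j _)%R.
pose beta := int_row b; rewrite -/beta in bB bL.
have bB1 : `|beta| <= B1 by rewrite le_max bB.
have be0 : 0 < `|beta *m T|.
  by apply: lt_le_trans bL; rewrite divr_gt0.
(* the parameter [t *: beta] is so small that [p] is close to its stable norm *)
have low : t * (c / 2) * `|beta *m T| <= p (t *: beta).
  have sb : 0 < t * `|beta *m T| <= s0.
    rewrite mulr_gt0//=; apply: (@le_trans _ _ (t * (cT * B1))).
      by rewrite ler_pM2l// (le_trans (Tb _))// ler_pM2l.
    by rewrite /t divfK// gt_eqF// mulr_gt0.
  have := sN _ (`|beta *m T|^-1 *: (beta *m T)) sb.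
  rewrite normrZ normfV normr_id mulVf ?gt_eqF// => /(_ (lexx 1)).
  rewrite scalerA mulfK ?gt_eqF// scalemxAl -pT (stable_normZ qF).
  rewrite normfV normr_id => h.
  have := Nc (beta *m T); rewrite -(@ler_pM2l _ `|beta *m T|^-1) ?invr_gt0//.
  move=> /le_trans /(_ h); rewrite mulrCA mulVf ?gt_eqF// mulr1 -lerBlDr.
  rewrite ler_pdivlMr; last exact: mulr_gt0 t0 be0.
  move=> /(le_trans _); apply.
  lra.
have mi0 := mesh_gt0 k_gt0 m_gt0 i.
have mit : mesh k m i <= t by near: i; exact: cvgr_le mesh0 _ t0.
pose j := Num.truncn (t / mesh k m i).
have /andP[j1 j2] : j%:R <= t / mesh k m i < j.+1%:R.
  by rewrite truncn_itv// divr_ge0// ltW.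
rewrite ler_pdivlMr// in j1; rewrite ltr_pdivrMr// -natr1 in j2.
have j0 : 0 < j%:R :> R.
  by rewrite ltr0n /j truncn_gt0// ler_pdivlMr// mul1r.
have gE : g *+ j = comb k m x i ((mesh k m i * j%:R) *: beta).
  rewrite /comb -sumrMnl; apply: eq_bigr => l _.
  have -> : ((mesh k m i * j%:R) *: beta) 0 l / mesh k m i = (b l * j%:Z)%:~R.
    rewrite !mxE intrM -pmulrn; move/lt0r_neq0: mi0 => mi0'.
    by field; exact: mi0'.
  by rewrite intrKfloor mulrzA pmulrn.
have up : plen k m x i ((mesh k m i * j%:R) *: beta) <= j%:R * rlen m g.
  rewrite /plen -gE /rlen mulrA ler_pM2r ?invr_gt0// -natrM ler_nat.
  exact: wlenMn.
have lip := plen_lip k_gt0 m_gt0 x4 i (t *: beta) ((mesh k m i * j%:R) *: beta).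
have tb : `|t *: beta - (mesh k m i * j%:R) *: beta| <= mesh k m i * B1.
  rewrite -scalerBl normrZ ler_pM// ger0_norm; lra.
have cv : `|plen k m x i (t *: beta) - p (t *: beta)| <= t / 2.
  have : forall v : 'rV_K, `|v| <= t * B1 -> `|plen k m x i v - p v| <= t / 2.
    by near: i; apply: p_cvg; rewrite divr_gt0.
  by apply; rewrite normrZ gtr0_norm// ler_pM2l.
have mC : mesh k m i * (Cm + 1) <= t / 2.
  rewrite -ler_pdivlMr; last by rewrite ltr_wpDl.
  near: i; apply: cvgr_le mesh0 _ _; apply: divr_gt0; last by rewrite ltr_wpDl.
  exact: divr_gt0.
have jr : t * (c / 2) * `|beta *m T| - t <= j%:R * rlen m g.
  move: cv; rewrite ler_norml => /andP[cv _].
  have := @ler_wpM2l _ (4 * K%:R) _ _ _ tb; rewrite mulr_ge0// => /(_ isT).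
  have : mesh k m i * Cm = 4 * K%:R * (mesh k m i * B1) + 4 * K%:R * (2 * mesh k m i).
    by rewrite /Cm; ring.
  lra.
have cL : 8 <= c * `|beta *m T| by rewrite mulrC -ler_pdivrMr.
have jr3 : t * 3 <= j%:R * rlen m g.
  by apply: le_trans jr; have := @ler_wpM2l _ t (ltW t0) _ _ cL; lra.
have : 3 * mesh k m i <= rlen m g.
  rewrite -(@ler_pM2l _ j%:R)// (le_trans _ jr3)//; lra.
rewrite /mesh /rlen mulrA ler_pM2r ?invr_gt0// -natrM ler_nat.
by apply: leq_trans; rewrite ltn_mul2r k_gt0.
Unshelve. all: by end_near. Qed.

(** Counting: the [A ^ d] integer points of a cube of R^d, lifted to R^K, dilated by
    [M] and rounded, are parameters of elements of length at most [A * n0 * k i],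
    which are pairwise at distance more than [2 * k i].  By packing and growth,
    there are at most of the order of [A ^ D'] such elements, whatever [A] is. *)
Lemma dimension_le (D' : R) : (forall j, (0 < j)%N -> \forall i \near \oo,
    #|` wball (G i) (j * k i)|%:R <= j%:R `^ D' * #|` wball (G i) (k i)|%:R :> R) ->
  d%:R <= D'.
Proof.
move=> growth.
have [L L0 sep] := separated_combinations.
have [cT cT0 Tb] := mulmx_bounded T; have [cI cI0 Ib] := mulmx_bounded I.
(* rounding moves parameters by at most 1 and hence their images by at most [cT];
   after dilation by [L + cT] distinct integer points remain [L] apart *)
pose M := L + cT; have M0 : 0 < M by rewrite addr_gt0.
pose n0 := (K * 4 * (Num.truncn (M * cI)).+2)%N.
have count A : (0 < A)%N -> A%:R ^+ d <= (A * n0.+1)%:R `^ D' :> R.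
  move=> A0.
  pose vec (a : {ffun 'I_d -> 'I_A}) : 'rV[R]_d := \row_j (a j)%:R.
  pose bvec a l : int := Num.floor (M * (vec a *m I) 0 l).
  have vecA a : `|vec a| <= A%:R.
    by apply: norm_le_coord => // j; rewrite mxE ger0_norm// ler_nat ltnW.
  have bvecA a l : `|(bvec a l)%:~R : R| <= M * cI * A%:R + 1.
    have /andP[] := floor_itv (M * (vec a *m I) 0 l).
    have : `|M * (vec a *m I) 0 l| <= M * cI * A%:R.
      rewrite normrM gtr0_norm// -mulrA ler_pM2l// (le_trans (coord_le_norm _ _))//.
      by rewrite (le_trans (Ib _))// ler_pM2l.
    rewrite -/(bvec a l) intrD !ler_norml => /andP[] *; apply/andP; split; lra.
  near \oo => i.
  have sepi : forall b : 'I_K -> int, `|int_row b| <= 2 * (M * cI * A%:R + 1) ->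
      L <= `|int_row b *m T| -> (2 * k i < wlen (\sum_j x i j *~ b j)%R)%N.
    by near: i; exact: sep.
  have gr : #|` wball (G i) (A * n0.+1 * k i)|%:R <=
      (A * n0.+1)%:R `^ D' * #|` wball (G i) (k i)|%:R :> R.
    by near: i; apply: growth; rewrite muln_gt0 A0.
  pose g a : G i := \sum_j x i j *~ bvec a j.
  have gsep a a' : (wlen (g a - g a') <= k i + k i)%N -> a = a'.
    move=> gk; apply: contrapT => /eqP aa'.
    pose b l := bvec a l - bvec a' l.
    have gb : g a - g a' = \sum_j x i j *~ b j.
      by rewrite -sumrB; apply: eq_bigr => j _; rewrite mulrzBr.
    suff : (2 * k i < wlen (g a - g a'))%N by lia.
    rewrite gb; apply: sepi.
      apply: norm_le_coord => [|l].
        by rewrite mulr_ge0// addr_ge0// !mulr_ge0// ltW.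
      rewrite mxE /b intrD mulrNz (le_trans (ler_normB _ _))//.
      by have := bvecA a l; have := bvecA a' l; lra.
    pose e := int_row b - M *: ((vec a - vec a') *m I).
    have e1 : `|e| <= 1.
      apply: norm_le_coord => // l; rewrite /e mulmxBl /b /bvec.
      move: (vec a *m I) (vec a' *m I) => P P'.
      rewrite !mxE intrD mulrNz mulrBr.
      have /andP[] := floor_itv (M * P 0 l); have /andP[] := floor_itv (M * P' 0 l).
      rewrite !intrD ler_norml => *; apply/andP; split; lra.
    have va : 1 <= `|vec a - vec a'|.
      have [j ja] : exists j, a j != a' j.
        apply: contrapT => /forallNP h; move/eqP: aa'; apply.
        by apply/ffunP => j; apply/eqP/negPn/negP/h.
      apply: le_trans (coord_le_norm _ j); rewrite !mxE.
      have : ((a j)%:Z - (a' j)%:Z)%:~R = (a j)%:R - (a' j)%:R :> R.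
        by rewrite intrD mulrNz -!pmulrn.
      move=> <-; rewrite -intr_norm (ler_int R 1) -gtz0_ge1 normr_gt0 subr_eq0.
      by apply: contra ja => /eqP[/val_inj ->].
    have -> : int_row b *m T = M *: (vec a - vec a') + e *m T.
      by rewrite mulmxBl -scalemxAl -mulmxA IT mulmx1 addrC subrK.
    have := ler_normB (M *: (vec a - vec a') + e *m T) (e *m T).
    rewrite addrK normrZ (gtr0_norm M0).
    have := Tb e.
    have := @ler_wpM2l _ cT (ltW cT0) _ _ e1.
    have := @ler_wpM2l _ M (ltW M0) _ _ va; rewrite /M; lra.
  have glen a : (wlen (g a) <= A * n0 * k i)%N.
    apply: leq_trans (wlen_sum _ _ _) _.
    apply: (@leq_trans (\sum_(j < K) A * (Num.truncn (M * cI)).+2 * (4 * k i))%N).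
      apply: leq_sum => j _; apply: leq_trans (wlenMz _ _) _.
      apply: leq_mul => //.
      have bA := bvecA a j.
      have : (`|bvec a j|%N)%:R <= (A * (Num.truncn (M * cI)).+2)%:R :> R.
        apply: (@le_trans _ _ (M * cI * A%:R + 1)).
          by rewrite pmulrn abszE intr_norm.
        have A1 : 1 <= A%:R :> R by rewrite ler1n.
        have := truncn_itv (mulr_ge0 (ltW M0) (ltW cI0)); move=> /andP[_ tr].
        rewrite natrM -natr1 mulrDr mulr1 lerD// mulrC ler_pM2l ?ltr0n//.
        exact: ltW.
      by rewrite ler_nat.
    by rewrite sum_nat_const card_ord /n0; apply: eq_leq; ring.
  have cnt : (size [seq g a | a <- enum {ffun 'I_d -> 'I_A}] * #|` wball (G i) (k i)|
      <= #|` wball (G i) (A * n0 * k i + k i)|)%N.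
    apply: card_separated.
    - rewrite map_inj_in_uniq ?enum_uniq// => a a' _ _ gg.
      by apply: gsep; rewrite gg subrr wlen0.
    - by move=> _ /mapP[a _ ->].
    - by move=> _ _ /mapP[a _ ->] /mapP[a' _ ->] /gsep ->.
  rewrite size_map -cardE card_ffun !card_ord in cnt.
  have b0 : 0 < #|` wball (G i) (k i)|%:R :> R by rewrite ltr0n wball_gt0.
  rewrite -(ler_pM2r b0); apply: le_trans gr.
  rewrite -natrX -natrM ler_nat (leq_trans cnt)//; apply: card_wball_le.
  nia.
rewrite leNgt; apply/negP => Dd.
pose dl := d%:R - D'; have dl0 : 0 < dl by rewrite subr_gt0.
pose c : R := n0.+1%:R `^ D'.
have cb A : (0 < A)%N -> A%:R `^ dl <= c.
  move=> A0; have A0' : 0 < A%:R :> R by rewrite ltr0n.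
  have := count A A0; rewrite natrM powRM// -powR_mulrn// mulrC => h.
  by rewrite /dl powRB// ?gt_eqF// ?ltr0n// ler_pdivrMr// powR_gt0.
have c0 : 0 < c by rewrite powR_gt0// ltr0n.
pose A := (Num.truncn (c `^ dl^-1)).+1.
have := cb A isT; apply/negP; rewrite -ltNge.
have /andP[_ cA] := truncn_itv (powR_ge0 c dl^-1).
have : (c `^ dl^-1) `^ dl < A%:R `^ dl.
  by apply: gt0_ltr_powR => //; rewrite nnegrE ?powR_ge0.
by rewrite -powRrM mulVf ?gt_eqF// powRr1// ltW.
Unshelve. all: by end_near. Qed.

End DimensionBound.

(** * Locally affine maps are smooth *)

Section Smooth.
Context (R : realType).

(** Differentiability is a property of a chosen linear map, so that the witness 0
    has to be exhibited first. *)
Lemma near0_differentiable (V W : normedModType R) (e : V -> W) x :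
  (\forall y \near x, e y = 0) -> differentiable e x.
Proof.
move=> e0; have ex := nbhs_singleton e0.
apply/diffP; apply: (@getPex _ (fun df : {linear V -> W} => continuous df /\
  forall y, e y = e (lim (nbhs x)) + df (y - lim (nbhs x))
                  +o_(y \near x) (y - lim (nbhs x)))).
exists (\0 : {linear V -> W}); split; first by move=> y; exact: cvg_cst.
pose k y := y - lim (nbhs x).
pose g y := e (lim (nbhs x)) + (\0 : V -> W) (k y).
suff h : e = g +o_ x k by move=> y; exact: (congr1 (@^~ y) h).
apply/eqaddoP => _/posnumP[eps]; near=> y.
have ey : e y = 0 by near: y.
have -> : (e - g) y = 0 by rewrite !fctE/g lim_id// ey ex/= !(addr0, subr0).
by rewrite normr0 mulr_ge0.
Unshelve. all: by end_near. Qed.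

Lemma near_eq_differentiable (V W : normedModType R) (f g : V -> W) x :
  (\forall y \near x, f y = g y) -> differentiable g x -> differentiable f x.
Proof.
move=> fg dg; have -> : f = g + (f \- g) by apply/funext => y; rewrite fctE addrC subrK.
apply: differentiableD => //; apply: near0_differentiable.
by near=> y; rewrite /= (near fg y)// subrr.
Unshelve. all: by end_near. Qed.

Lemma affine_derive (V W : normedModType R) (f : V -> W) (L : {linear V -> W})
    (b : W) x v : continuous L -> (\forall y \near x, f y = L y + b) ->
  differentiable f x /\ 'D_v f x = L v.
Proof.
move=> Lc fb; have dL : differentiable (L : V -> W) x by exact: linear_differentiable.
split; first by apply: near_eq_differentiable fb _; exact: differentiableD.
rewrite (near_eq_derive _ (g := (L : V -> W) + cst b))// deriveE; last first.
  exact: differentiableD.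
by rewrite diffD// /= diff_lin// diff_cst /= addr0.
Qed.

(** Coordinate changes and group operations of a torus are locally affine. *)
Lemma affine_smooth (V W : normedModType R) (U : set V) (f : V -> W)
    (L : {linear V -> W}) : continuous L ->
  (forall x, U x -> exists b, \forall y \near x, f y = L y + b) ->
  smooth_on U f.
Proof.
move=> Lc Lf k; elim: k f L Lc Lf => [|k IHk] f L Lc Lf.
  move=> x /Lf[b fb]; apply: differentiable_continuous.
  by have [] := affine_derive 0 Lc fb.
split=> [x /Lf[b fb]|v]; first by have [] := affine_derive 0 Lc fb.
apply: (IHk _ (\0 : {linear V -> W})); first by move=> y; exact: cvg_cst.
move=> x /Lf[b fb]; exists (L v).
have := near_join fb; apply: filterS => y fy.
by rewrite (affine_derive v Lc fy).2 /= add0r.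
Qed.

End Smooth.

(** * Quotients of R^d by kernels of pseudonorms *)

Section MetricLemmas.
Context (R : realType).

Lemma metric_ball_open (M : metricType R) (x : M) (r : R) :
  open [set y | mdist x y < r].
Proof.
rewrite openE => y /= xy; apply/nbhs_ballP.
exists (r - mdist x y); rewrite /= ?subr_gt0// ballEmdist => z /= yz.
by apply: le_lt_trans (metric_triangle _ y _) _; rewrite -ltrBrDl.
Qed.

Lemma lipschitz_continuous (V : normedModType R) (M : metricType R) (f : V -> M) (C : R) :
  0 < C -> (forall u v, mdist (f u) (f v) <= C * `|u - v|) -> continuous f.
Proof.
move=> C0 fC v; apply/metricType_numDomainType.cvgrPdist_lt => e e0; near=> w.
apply: le_lt_trans (fC _ _) _; rewrite mulrC -ltr_pdivlMr//; near: w.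
by apply: cvgr_dist_lt => //; rewrite divr_gt0.
Unshelve. all: by end_near. Qed.

Lemma open_norm_ball (V : normedModType R) (a : V) (r : R) :
  open [set u : V | `|u - a| < r].
Proof.
apply: (@open_comp _ _ (fun u : V => `|u - a|) [set x : R | x < r]).
  by move=> u _; apply: cvg_norm; apply: cvgB; [exact: cvg_id | exact: cvg_cst].
exact: open_lt.
Qed.

Lemma metric_continuous_at (M : metricType R) (V : normedModType R) (f : M -> V) x :
  (forall e : R, 0 < e -> exists2 r : R, 0 < r &
    forall y, mdist x y < r -> `|f x - f y| < e) -> {for x, continuous f}.
Proof.
move=> fP; apply/cvgrPdist_lt => e /fP[r r0 rP]; near=> y; apply: rP; near: y.
exact: metricType_numDomainType.cvgr_dist_lt.
Unshelve. all: by end_near. Qed.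

End MetricLemmas.

Section Torus.
Context (R : realType) (d : nat) (q : 'rV[R]_d -> R) (C : R) (qF : flat q C).
Implicit Types (a u v w : 'rV[R]_d).

(** The proof argument ties the quotient type below to [qF], from which its
    group and metric structures are inferred. *)
Definition flat_repr (_ : flat q C) v : 'rV[R]_d := choose (fun w => q (v - w) == 0) v.
Local Notation torus_repr := (flat_repr qF).

Lemma torus_reprK v : q (v - torus_repr v) = 0.
Proof.
by apply/eqP/(@chooseP _ (fun w => q (v - w) == 0)); rewrite subrr (flat0 qF).
Qed.

Lemma torus_repr_eq u v : q (u - v) = 0 -> torus_repr u = torus_repr v.
Proof.
move=> uv; have uvE : (fun w => q (u - w) == 0) =1 (fun w => q (v - w) == 0).
  by move=> w; rewrite -(flat_eq qF (u := u - w) (v := v - w))// opprB addrA subrK.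
rewrite /flat_repr (eq_choose uvE); apply: choose_id.
  by rewrite -uvE subrr (flat0 qF).
by rewrite subrr (flat0 qF).
Qed.

Lemma torus_repr_id v : torus_repr (torus_repr v) == torus_repr v.
Proof. by apply/eqP/torus_repr_eq; rewrite (flatBC qF) torus_reprK. Qed.

(** The quotient of R^d by the kernel of [q], with canonical representatives.  It is
    compact only if the kernel has full rank. *)
Record torus : Type := Torus {
  torus_val : 'rV[R]_d; _ : torus_repr torus_val == torus_val }.

HB.instance Definition _ := [isSub for torus_val].
HB.instance Definition _ := [Choice of torus by <:].

Implicit Types (x y z : torus).

Definition torus_pi v : torus := Torus (torus_repr_id v).
Local Notation pi := torus_pi.

Lemma torus_piK x : pi (torus_val x) = x.
Proof. by apply: val_inj => /=; apply/eqP; case: x. Qed.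

Lemma torus_piP u v : pi u = pi v <-> q (u - v) = 0.
Proof.
split=> [[uv]|uv]; last by apply: val_inj; exact: torus_repr_eq.
apply/eqP; rewrite eq_le (flat_ge0 qF) andbT.
have := flatB_trans qF u (torus_repr u) v.
by rewrite torus_reprK add0r uv (flatBC qF (torus_repr v)) torus_reprK.
Qed.

Lemma torus_ind (P : torus -> Prop) : (forall v, P (pi v)) -> forall x, P x.
Proof. by move=> Ppi x; rewrite -(torus_piK x). Qed.

Definition torus_add x y := pi (torus_val x + torus_val y).
Definition torus_opp x := pi (- torus_val x).

Lemma torus_addE u v : torus_add (pi u) (pi v) = pi (u + v).
Proof.
apply/torus_piP => /=; apply/eqP; rewrite eq_le (flat_ge0 qF) andbT.
have := flatD qF (torus_repr u - u) (torus_repr v - v).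
by rewrite addrACA -opprD !(flatBC qF _ u, flatBC qF _ v) !torus_reprK addr0.
Qed.

Lemma torus_oppE u : torus_opp (pi u) = pi (- u).
Proof. by apply/torus_piP; rewrite /= opprK addrC torus_reprK. Qed.

Let torus_addA : associative torus_add.
Proof. by elim/torus_ind => u; elim/torus_ind => v; elim/torus_ind => w; rewrite !torus_addE addrA. Qed.
Let torus_addC : commutative torus_add.
Proof. by elim/torus_ind => u; elim/torus_ind => v; rewrite !torus_addE addrC. Qed.
Let torus_add0 : left_id (pi 0) torus_add.
Proof. by elim/torus_ind => u; rewrite torus_addE add0r. Qed.
Let torus_addN : left_inverse (pi 0) torus_opp torus_add.
Proof. by elim/torus_ind => u; rewrite torus_oppE torus_addE addNr. Qed.

HB.instance Definition _ :=
  GRing.isZmodule.Build torus torus_addA torus_addC torus_add0 torus_addN.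

Lemma torus_piD u v : pi (u + v) = pi u + pi v.
Proof. by rewrite -torus_addE. Qed.

Lemma torus_piN u : pi (- u) = - pi u.
Proof. by rewrite -torus_oppE. Qed.

Lemma torus_piB u v : pi (u - v) = pi u - pi v.
Proof. by rewrite torus_piD torus_piN. Qed.

Lemma torus_pi0 : pi 0 = 0.
Proof. by []. Qed.

Definition torus_dist x y := q (torus_val x - torus_val y).

Lemma torus_distE u v : torus_dist (pi u) (pi v) = q (u - v).
Proof.
apply: (flat_eq qF); rewrite /torus_dist /=.
apply/eqP; rewrite eq_le (flat_ge0 qF) andbT.
have := flatD qF (torus_repr u - u) (v - torus_repr v).
rewrite (flatBC qF _ u) !torus_reprK addr0; congr (q _ <= _).
by rewrite opprB [v - u]addrC [RHS]addrACA [v - torus_repr v]addrC.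
Qed.

Let torus_distxx x : torus_dist x x = 0.
Proof. by rewrite /torus_dist subrr (flat0 qF). Qed.
Let torus_dist_eq0 x y : torus_dist x y = 0 -> x = y.
Proof. by move/torus_piP; rewrite !torus_piK. Qed.
Let torus_dist_sym x y : torus_dist x y = torus_dist y x.
Proof. exact: (flatBC qF). Qed.
Let torus_dist_triangle y x z : torus_dist x z <= torus_dist x y + torus_dist y z.
Proof. exact: (flatB_trans qF). Qed.

HB.instance Definition _ := @isMetric.Build R torus torus_dist torus_distxx
  torus_dist_eq0 torus_dist_sym torus_dist_triangle.

Lemma torus_mdist u v : mdist (pi u) (pi v) = q (u - v).
Proof. exact: torus_distE. Qed.

Lemma torus_mdistB x y z : mdist (x - z) (y - z) = mdist x y.
Proof.
elim/torus_ind: x => u; elim/torus_ind: y => v; elim/torus_ind: z => w.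
by rewrite -!torus_piB !torus_mdist opprB addrA subrK.
Qed.

Lemma torus_mdistDl x y z : mdist (z + x) (z + y) = mdist x y.
Proof.
elim/torus_ind: x => u; elim/torus_ind: y => v; elim/torus_ind: z => w.
by rewrite -!torus_piD !torus_mdist opprD addrACA subrr add0r.
Qed.

Lemma torus_mdistN x y : mdist (- x) (- y) = mdist x y.
Proof.
elim/torus_ind: x => u; elim/torus_ind: y => v.
by rewrite -!torus_piN !torus_mdist -opprD (flatN qF).
Qed.

Lemma torus_mdist0 v : mdist (0 : torus) (pi v) = q v.
Proof. by rewrite -torus_pi0 torus_mdist sub0r (flatN qF). Qed.

Let torus_sub_continuous : continuous (fun x : torus * torus => x.1 - x.2).
Proof.
move=> [x y]; apply/metricType_numDomainType.cvgrPdist_lt => e e0; near=> z => /=.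
have xz : mdist x z.1 < e / 2.
  near: z; apply: metricType_numDomainType.cvgr_dist_lt; last by rewrite divr_gt0.
  exact: cvg_fst.
have yz : mdist y z.2 < e / 2.
  near: z; apply: metricType_numDomainType.cvgr_dist_lt; last by rewrite divr_gt0.
  exact: cvg_snd.
apply: le_lt_trans (metric_triangle _ (z.1 - y) _) _.
by rewrite torus_mdistB torus_mdistDl torus_mdistN [ltRHS](splitr e) ltrD.
Unshelve. all: by end_near. Qed.

HB.instance Definition _ := PreTopologicalNmodule_isTopologicalZmodule.Build torus
  torus_sub_continuous.

Definition torus_group : topologicalZmodType := torus.

Lemma torus_pi_lip u v : mdist (pi u) (pi v) <= C * `|u - v|.
Proof. by rewrite torus_mdist; exact: flat_le qF _. Qed.

Lemma torus_pi_continuous : continuous pi.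
Proof. exact: lipschitz_continuous (flat_gt0 qF) torus_pi_lip. Qed.

(** This makes the projection open: representatives can be chosen as close as the
    distance in the quotient allows. *)
Lemma torus_lift u x : exists2 w, x = pi (u + w) & `|w| <= C * mdist (pi u) x.
Proof.
elim/torus_ind: x => v; have [w vw wC] := flat_rep qF (v - u).
exists w; last by rewrite torus_mdist (flatBC qF).
by apply/torus_piP; rewrite opprD addrA.
Qed.

Lemma torus_connected : connected [set: torus].
Proof.
have -> : [set: torus] = \bigcup_(v in [set: 'rV[R]_d]) ((fun t : R => pi (t *: v)) @` `[0, 1]).
  apply/esym/seteqP; split => // x _; exists (torus_val x) => //=.
  by exists 1; rewrite /= ?in_itv/= ?ler01 ?lexx// scale1r torus_piK.
apply: bigcup_connected.
  exists 0 => v _; exists 0; rewrite /= ?in_itv/= ?ler01 ?lexx//.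
  by rewrite scale0r.
move=> v _; apply: connected_continuous_connected; first exact: segment_connected.
apply: continuous_subspaceT => t; apply: continuous_comp; last exact: torus_pi_continuous.
exact: scalel_continuous.
Qed.

Lemma torus_second_countable : @second_countable torus.
Proof.
pose ratv (w : 'rV[rat]_d) : 'rV[R]_d := map_mx ratr w.
pose U (p : 'rV[rat]_d * nat) : set torus := [set x | mdist (pi (ratv p.1)) x < p.2.+1%:R^-1].
exists (U @` setT).
  exact: card_le_trans (card_image_le _ _) (countableP _).
split => [_ [p _ <-]|x].
  exact: metric_ball_open.
move=> A /nbhs_ballP[e /= e0 xA].
elim/torus_ind: x xA => v; rewrite ballEmdist => vA.
pose n := Num.truncn (2 / e).
have ne : n.+1%:R^-1 < e / 2.
  rewrite invf_plt ?posrE ?divr_gt0//.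
  have e2 : 0 <= 2 / e by rewrite divr_ge0// ltW.
  by rewrite invf_div; have /andP[] := truncn_itv e2.
have C0 := flat_gt0 qF.
have [w vw] : exists w : 'rV[rat]_d, C * `|v - ratv w| < n.+1%:R^-1.
  pose N := (Num.truncn (C * n.+1%:R)).+1.
  exists (\row_j ((Num.floor (N%:R * v 0 j))%:~R / N%:R)).
  have N0 : 0 < N%:R :> R by rewrite ltr0n.
  rewrite mulrC -ltr_pdivlMr//; apply: (@le_lt_trans _ _ N%:R^-1).
    apply: norm_le_coord => [|j]; first by rewrite invr_ge0 ltW.
    rewrite !mxE fmorph_div/= ratr_int ratr_nat.
    have /andP[] := floor_itv (N%:R * v 0 j).
    have -> : v 0 j - (Num.floor (N%:R * v 0 j))%:~R / N%:R =
        N%:R^-1 * (N%:R * v 0 j - (Num.floor (N%:R * v 0 j))%:~R).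
      by rewrite mulrBr mulKf ?gt_eqF// mulrC.
    rewrite intrD normrM (gtr0_norm (_ : 0 < N%:R^-1)) ?invr_gt0// => f1 f2.
    by rewrite ger_pMr ?invr_gt0// ler_norml; apply/andP; split; lra.
  rewrite -invfM ltf_pV2 ?posrE ?mulr_gt0// mulrC.
  by have /andP[] := truncn_itv (mulr_ge0 (ltW C0) (ler0n R n.+1)).
exists (U (w, n)).
- split; first by exists (w, n).
  by rewrite /U/= metric_sym (le_lt_trans (torus_pi_lip _ _))// /ratv.
- move=> y; rewrite /U/= => wy; apply: vA => /=.
  apply: le_lt_trans (metric_triangle _ (pi (ratv w)) _) _.
  rewrite (splitr e) ltrD//; last exact: lt_trans wy ne.
  by apply: le_lt_trans (torus_pi_lip _ _) _; exact: lt_trans vw ne.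
Qed.

Hypothesis q_def : forall v, stable_norm q v = 0 -> v = 0.

Lemma torus_rad_subproof :
  exists r : R, 0 < r /\ forall v, q v = 0 -> `|v| < r -> v = 0.
Proof. by have [r r0 rP] := flat_ker_discrete qF q_def; exists r. Qed.

(** Half of a radius in which the kernel has no nonzero vector: two vectors at
    distance less than this from a common centre differ by less than the radius. *)
Definition torus_rad : R := sval (cid torus_rad_subproof) / 2.
Local Notation rad := torus_rad.

Lemma torus_rad_gt0 : 0 < rad.
Proof. by rewrite /rad; case: cid => r /= [r0 _]; rewrite divr_gt0. Qed.

Lemma torus_rad_inj a u v : `|u - a| < rad -> `|v - a| < rad -> pi u = pi v -> u = v.
Proof.
rewrite /rad; case: cid => r /= [r0 rP] ua va /torus_piP uv.
apply/eqP; rewrite -subr_eq0; apply/eqP/rP => //.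
have -> : u - v = (u - a) - (v - a) by rewrite opprB addrA subrK.
by rewrite (le_lt_trans (ler_normB _ _))// [ltRHS](splitr r) ltrD.
Qed.

Definition torus_log a x : 'rV[R]_d := xget a [set u | `|u - a| < rad /\ pi u = x].

Lemma torus_logK a u : `|u - a| < rad -> torus_log a (pi u) = u.
Proof.
move=> ua; have [va vE] : [set w | `|w - a| < rad /\ pi w = pi u] (torus_log a (pi u)).
  by apply: xgetPex; exists u.
exact: torus_rad_inj va ua vE.
Qed.

Definition torus_dom a : set torus := pi @` [set u | `|u - a| < rad].

(** Two lifts of a curve differ by a constant element of the discrete kernel, so
    that chart changes are locally translations. *)
Lemma torus_log_near a u : torus_dom a (pi u) ->
  exists b, \forall v \near u, torus_log a (pi v) = v + b.
Proof.
move=> [w /= wa wu]; exists (w - u); near=> v.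
have -> : pi v = pi (v + (w - u)).
  by rewrite torus_piD torus_piB wu subrr addr0.
apply: torus_logK.
have -> : v + (w - u) - a = (w - a) - (u - v).
  by rewrite opprB addrCA addrAC.
rewrite (le_lt_trans (ler_normB _ _))// -ltrBrDl; near: v.
by apply: cvgr_dist_lt => //; rewrite subr_gt0.
Unshelve. all: by end_near. Qed.

Lemma torus_log_continuous a x : torus_dom a x -> {for x, continuous (torus_log a)}.
Proof.
move=> [u /= ua <-]; apply: metric_continuous_at => e e0.
have C0 := flat_gt0 qF.
exists (Num.min e (rad - `|u - a|) / C); first by rewrite divr_gt0// lt_min e0 subr_gt0.
move=> y; have [w yE wy] := torus_lift u y.
rewrite ltr_pdivlMr// mulrC lt_min => /andP[ye yr].
rewrite yE !torus_logK//.
  by rewrite opprD addrA subrr add0r normrN (le_lt_trans wy).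
rewrite addrAC (le_lt_trans (ler_normD _ _))// -ltrBrDl.
exact: le_lt_trans wy yr.
Qed.

Lemma torus_dom_open a : open (torus_dom a).
Proof.
rewrite openE => _ /= [u ua <-].
have C0 := flat_gt0 qF.
apply/nbhs_ballP; exists ((rad - `|u - a|) / C); first by rewrite /= divr_gt0// subr_gt0.
move=> y; rewrite ballEmdist /= ltr_pdivlMr// mulrC => uy.
have [w yE wy] := torus_lift u y; exists (u + w) => //=.
rewrite addrAC (le_lt_trans (ler_normD _ _))// -ltrBrDl.
exact: le_lt_trans wy uy.
Qed.

Lemma torus_img_open a : open [set u : 'rV[R]_d | `|u - a| < rad].
Proof. exact: open_norm_ball. Qed.

Definition torus_chart a : chart R d torus_group.
Proof.
refine (@Chart R d torus_group (torus_dom a) [set u | `|u - a| < rad]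
  (torus_log a) pi (@torus_dom_open a) (@torus_img_open a) _ _ _ _ _ _).
- by move=> _ [u ua <-]; rewrite /= torus_logK.
- by move=> u ua; exists u.
- by move=> _ [u ua <-]; rewrite torus_logK.
- by move=> u ua; rewrite torus_logK.
- exact: torus_log_continuous.
- by move=> u _; exact: torus_pi_continuous.
Defined.

(** The group operations and the identity lift to linear maps [L], which covers all
    smoothness conditions on a Lie group. *)
Lemma torus_log_smooth a (V : normedModType R) (U : set V) (f : V -> torus)
    (L : {linear V -> 'rV[R]_d}) : continuous L -> (forall p, f p = pi (L p)) ->
  smooth_on [set p | U p /\ torus_dom a (f p)] (torus_log a \o f).
Proof.
move=> Lc fE; apply: (affine_smooth Lc) => p [_]; rewrite fE => /torus_log_near[b bP].
have Lb : \forall y \near p, torus_log a (pi (L y)) = L y + b := Lc p _ bP.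
by exists b; apply: filterS Lb => y /= yb; rewrite fE.
Qed.

Definition torus_atlas : set (chart R d torus_group) := range torus_chart.

Definition torus_lie : abelianLieGroup R d.
Proof.
refine (@AbelianLieGroup R d torus_group _ _ torus_atlas _ _ _ _).
- exact: metric_hausdorff.
- exact: torus_second_countable.
- move=> x; exists (torus_chart (torus_val x)); first by exists (torus_val x).
  by exists (torus_val x); rewrite /= ?subrr ?normr0 ?torus_rad_gt0// torus_piK.
- move=> _ _ [a _ <-] [b _ <-]; pose L := (idfun : {linear 'rV[R]_d -> 'rV[R]_d}).
  by apply: (@torus_log_smooth b _ _ pi L) => // u; exact: cvg_id.
- move=> _ _ _ [a _ <-] [b _ <-] [c _ <-].
  pose L (p : 'rV[R]_d * 'rV[R]_d) := p.1 + p.2.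
  have Ll : linear L by move=> k u v; rewrite /L /= scalerDr addrACA.
  pose Lin : {linear _ -> _} := HB.pack L (GRing.isLinear.Build _ _ _ _ _ Ll).
  have := @torus_log_smooth c _ [set p | `|p.1 - a| < rad /\ `|p.2 - b| < rad]
    (fun p : 'rV[R]_d * 'rV[R]_d => pi p.1 + pi p.2) Lin.
  have -> : [set p | [set p | `|p.1 - a| < rad /\ `|p.2 - b| < rad] p /\
      torus_dom c (pi p.1 + pi p.2)] = [set p | [/\ `|p.1 - a| < rad,
      `|p.2 - b| < rad & torus_dom c (pi p.1 + pi p.2)]].
    by apply/seteqP; split => p /= => [[[? ?] ?]|[? ? ?]].
  apply; first exact: add_continuous.
  by move=> p; rewrite -torus_piD.
- move=> _ _ [a _ <-] [b _ <-].
  apply: (@torus_log_smooth b _ _ (fun u => - pi u) (-%R : {linear 'rV[R]_d -> 'rV[R]_d})).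
    exact: opp_continuous.
  by move=> u; rewrite -torus_piN.
Defined.

End Torus.

(** * The Finsler distance of a torus *)

Section RealInduction.
Context (R : realType).

Lemma real_induction (P : R -> Prop) : P 0 ->
  (forall t, 0 <= t < 1 -> P t ->
     exists2 e : R, 0 < e & forall s, t < s < t + e -> P s) ->
  (forall t, 0 < t <= 1 -> (forall s, 0 <= s < t -> P s) -> P t) ->
  P 1.
Proof.
move=> P0 Pr Pl.
pose S : set R := [set t | 0 <= t <= 1 /\ forall s, 0 <= s <= t -> P s].
have S0 : S 0.
  split; first by rewrite lexx ler01.
  by move=> s /andP[s0 s0']; have -> : s = 0 by apply/eqP; rewrite eq_le s0 s0'.
have Ssup : has_sup S by split; [exists 0 | exists 1 => t [/andP[]]].
pose t := sup S.
have t0 : 0 <= t by apply: ub_le_sup => //; case: Ssup.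
have t1 : t <= 1 by apply: ge_sup; [exists 0 | move=> s [/andP[]]].
have Plt s : 0 <= s < t -> P s.
  move=> /andP[s0 st]; have ts0 : 0 < t - s by rewrite subr_gt0.
  have [r [r1 Pr'] sr] := sup_adherent ts0 Ssup.
  apply: Pr'; rewrite s0/=; apply: ltW; move: sr; rewrite -/t; lra.
have Pt : P t.
  have [->//|tn0] := eqVneq t 0.
  by apply: Pl => //; rewrite t1 andbT lt_neqAle eq_sym tn0.
have [<-//|tn1] := eqVneq t 1.
have t_lt1 : t < 1 by rewrite lt_neqAle tn1.
have [|e e0 Pe] := Pr t _ Pt; first by rewrite t0 t_lt1.
pose r := Num.min 1 (t + e / 2).
have rt : t < r by rewrite lt_min t_lt1 ltrDl divr_gt0.
suff : S r by move=> Sr; have := ub_le_sup (proj2 Ssup) Sr; rewrite leNgt -/t rt.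
split; first by rewrite (le_trans t0 (ltW rt))/= ge_min lexx.
move=> s /andP[s0]; rewrite le_min => /andP[s1 se].
have [st|ts|->//] := ltgtP s t; first by apply: Plt; rewrite s0.
by apply: Pe; rewrite ts/= (le_lt_trans se)// ltrD2l; lra.
Qed.

Lemma itv_partition_right (s : seq R) (a b t : R) : itv_partition a b s ->
  a <= t < b -> exists2 i, (i < size s)%N &
    nth 0 (a :: s) i <= t < nth 0 (a :: s) i.+1.
Proof.
elim: s a => [|x s IHs] a; first by move=> /itv_partition_nil ->; lra.
move=> /itv_partition_cons sP /andP[ta tb].
have [tx|xt] := ltP t x; first by exists 0%N => //=; rewrite ta tx.
by have [|i si it] := IHs x sP; [rewrite xt tb | exists i.+1].
Qed.

Lemma itv_partition_left (s : seq R) (a b t : R) : itv_partition a b s ->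
  a < t <= b -> exists2 i, (i < size s)%N &
    nth 0 (a :: s) i < t <= nth 0 (a :: s) i.+1.
Proof.
elim: s a => [|x s IHs] a; first by move=> /itv_partition_nil ->; lra.
move=> /itv_partition_cons sP /andP[ta tb].
have [tx|xt] := leP t x; first by exists 0%N => //=; rewrite ta tx.
by have [|i si it] := IHs x sP; [rewrite xt tb | exists i.+1].
Qed.

Lemma measurable_fun_seq (s : seq R) (f : R -> R) :
  measurable ([set` s] : set R) /\ measurable_fun [set` s] f.
Proof.
elim: s => [|a s [mS mf]].
  by rewrite set_nil; split => //; exact: measurable_fun_set0.
have -> : [set` a :: s] = [set a] `|` [set` s].
  apply/seteqP; split => x /=; rewrite inE; first by move=> /orP[/eqP|]; [left|right].
  by move=> [->|->]; rewrite ?eqxx ?orbT.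
split; first exact: measurableU.
by apply/measurable_funU => //; split => //; exact: measurable_fun_set1.
Qed.

Lemma nearRP (P : R -> Prop) (t : R) : (\forall s \near t, P s) <->
  exists2 r : R, 0 < r & forall s, `|t - s| < r -> P s.
Proof.
split=> [/nbhs_ballP[r /= r0 rP]|[r r0 rP]]; first by exists r.
by apply/nbhs_ballP; exists r.
Qed.

Lemma continuous_eps (V : normedModType R) (f : R -> V) (t : R) :
  {for t, continuous f} -> forall e : R, 0 < e ->
  \forall s \near t, `|f t - f s| < e.
Proof. by move=> /cvgrPdist_lt. Qed.

Lemma near_eq_continuous (f h : R -> R) (t : R) : (\forall s \near t, f s = h s) ->
  {for t, continuous f} -> {for t, continuous h}.
Proof.
move=> fh fc; rewrite /prop_for /continuous_at -(nbhs_singleton fh).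
by apply: cvg_trans fc; exact: near_eq_cvg.
Qed.

Lemma leeD_EFin (y : \bar R) (a b c e : R) : a + b <= c + e ->
  (y + a%:E + b%:E <= y + c%:E + e%:E)%E.
Proof. by move=> h; rewrite -!addeA -!EFinD leeD2l// lee_fin. Qed.

Lemma lipschitz_norm_continuous (V W : normedModType R) (f : V -> W) (C : R) :
  0 < C -> (forall u v, `|f u - f v| <= C * `|u - v|) -> continuous f.
Proof.
move=> C0 fC v; apply/cvgrPdist_lt => e e0; near=> w.
apply: le_lt_trans (fC _ _) _; rewrite mulrC -ltr_pdivlMr//; near: w.
by apply: cvgr_dist_lt => //; exact: divr_gt0.
Unshelve. all: by end_near. Qed.

Lemma differentiable_eps (V : normedModType R) (k : R -> V) (t e : R) :
  0 < e -> differentiable k t -> exists2 r : R, 0 < r & forall s, t < s < t + r ->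
    `|(s - t)^-1 *: (k s - k t) - derive1 k t| <= e.
Proof.
move=> e0 kd; have /cvg_ex[l kl] : derivable k t 1 := diff_derivable kd.
have -> : derive1 k t = l by rewrite derive1E; apply: cvg_lim.
have /cvgrPdist_lt/(_ e e0) := kl; rewrite /= near_withinE => /nearRP[r r0 rP].
exists r => // s /andP[ts sr]; have st0 : 0 < s - t by rewrite subr_gt0.
have := rP (s - t); rewrite sub0r normrN gtr0_norm// gt_eqF//.
have -> : (s - t) < r by lra.
move=> /(_ isT isT); rewrite distrC => /ltW.
by rewrite (_ : (s - t) *: 1 = s - t) ?subrK// [LHS]mulr1.
Qed.

End RealInduction.

Section FinslerTorus.
Context (R : realType) (d : nat) (q : 'rV[R]_d -> R) (C : R) (qF : flat q C)
  (q_def : forall v, stable_norm q v = 0 -> v = 0).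
Local Notation A := (torus_lie qF q_def).
Local Notation pi := (torus_pi qF).
Local Notation c0 := (torus_chart qF q_def 0).
Local Notation N := (stable_norm q).
Local Notation log := (torus_log q_def).
Local Notation rad := (torus_rad qF q_def).

Definition velocity (g : R -> A) (t : R) : 'rV[R]_d :=
  derive1 (fun s : R => cmap c0 (g s - g t)) t.

Lemma torus_log0 (u : 'rV[R]_d) : `|u| < rad -> cmap c0 (pi u) = u.
Proof. by move=> ur; apply: torus_logK; rewrite subr0. Qed.

Lemma velocity_near (g h : R -> A) t : (\forall s \near t, g s = h s) ->
  velocity g t = velocity h t.
Proof.
move=> gh; rewrite /velocity !derive1E; apply: near_eq_derive.
by have := nbhs_singleton gh => gt; apply: filterS gh => s gs; rewrite gs gt.
Qed.

(** Translating by [- g t] brings the curve into the chart around 0, where it is the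
    difference of two values of a lift. *)
Lemma velocity_lift (h : R -> A) (k : R -> 'rV[R]_d) (t : R) :
  {for t, continuous k} -> (\forall s \near t, h s = pi (k s)) ->
  velocity h t = derive1 k t.
Proof.
move=> kc hk; rewrite /velocity !derive1E.
have -> : 'D_1 k t = 'D_1 (fun s => k s - k t) t.
  rewrite /derive; apply: (congr1 (fun f => lim (f @ 0^'))).
  by apply/funext => s /=; rewrite subrr subr0.
apply: near_eq_derive; have ht := nbhs_singleton hk.
have kt : \forall s \near t, `|k t - k s| < rad.
  by apply: continuous_eps; [exact: kc | exact: torus_rad_gt0].
apply: filterS2 hk kt => s hs ks; rewrite hs ht -torus_piB torus_log0//.
by rewrite distrC.
Qed.

Lemma smooth_curve_lift (h : R -> A) t : smooth_curve_at h t ->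
  exists k : R -> 'rV[R]_d, [/\ \forall s \near t, h s = pi (k s),
    \forall s \near t, differentiable k s &
    \forall s \near t, {for s, continuous (derive1 k)}].
Proof.
move=> [hc hs].
have atc : @atlas R d A (torus_chart qF q_def (torus_val (h t))) by exists (torus_val (h t)).
have dt : cdom (torus_chart qF q_def (torus_val (h t))) (h t).
  exists (torus_val (h t)); first by rewrite /= subrr normr0 torus_rad_gt0.
  exact: torus_piK.
have [U Ut kU] := hs _ atc dt.
have Un : nbhs t U by case: Ut => Uo Ut; exact: open_nbhs_nbhs.
exists (fun s => cmap (torus_chart qF q_def (torus_val (h t))) (h s)); split.
- have : \forall s \near t, torus_dom q_def (torus_val (h t)) (h s).
    apply: hc; apply: open_nbhs_nbhs; split => //; exact: torus_dom_open.
  by apply: filterS => s [u ua <-]; rewrite /= torus_logK.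
- by apply: filterS Un => s Us; exact: (proj1 (kU 1%N) s Us).
- apply: filterS Un => s Us.
  have := differentiable_continuous (proj1 (proj2 (kU 2%N) 1) s Us).
  set f := (fun r : R^o => cmap _ (h r)).
  by have -> : derive1 f = 'D_1 f by apply/funext => r; rewrite derive1E.
Qed.

Lemma stable_norm_continuous : continuous N.
Proof.
apply: (lipschitz_norm_continuous (flat_gt0 qF)) => v w; rewrite ler_norml.
have := stable_norm_lip qF v w; have := stable_norm_lip qF w v.
rewrite (distrC w); lra.
Qed.

Lemma stable_norm_increment (k : R -> 'rV[R]_d) (t e : R) : 0 < e ->
  differentiable k t -> exists2 r : R, 0 < r & forall s, t < s < t + r ->
    N (k s - k t) <= (s - t) * (N (derive1 k t) + e).
Proof.
move=> e0 kd; have C0 := flat_gt0 qF; have eC : 0 < e / C by rewrite divr_gt0.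
have [r r0 rP] := differentiable_eps eC kd; exists r => // s tsr.
have st0 : 0 < s - t by case/andP: tsr; rewrite subr_gt0.
rewrite -ler_pdivrMl// -[(s - t)^-1]gtr0_norm ?invr_gt0// -(stable_normZ qF).
apply: le_trans (stable_norm_lip qF _ (derive1 k t)) _.
by rewrite lerD2l mulrC -ler_pdivlMr// rP.
Qed.

Section LowerBound.
Context (g : R -> A) (s : seq R) (sP : itv_partition 0 1 s).
Hypothesis gP : forall i, (i < size s)%N ->
  let J := `[nth 0 (0 :: s) i, nth 0 (0 :: s) i.+1] in
  exists2 h : R -> A, {in J, forall t, smooth_curve_at h t} & {in J, g =1 h}.
Local Notation T i := (nth 0 (0 :: s) i).

(** The closed interval [T i, T i.+1] matters at break points, where the curve [g]
    coincides with the smooth curve [pi \o k] on one side only, while [k] is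
    smooth on both sides. *)
Lemma piecewise_lift i (t : R) : (i < size s)%N -> T i <= t <= T i.+1 ->
  exists (k : R -> 'rV[R]_d) (r : R), [/\ 0 < r,
    forall u : R, `|t - u| < r -> T i <= u <= T i.+1 -> g u = pi (k u),
    forall u : R, `|t - u| < r -> T i < u < T i.+1 -> velocity g u = derive1 k u,
    forall u : R, `|t - u| < r -> differentiable k u &
    forall u : R, `|t - u| < r -> {for u, continuous (derive1 k)}].
Proof.
move=> si ti; have [h hs gh] := gP si.
have [|k [hk dk ck]] := @smooth_curve_lift h t; first by apply: hs; rewrite in_itv.
have /nearRP[r r0 rP] : \forall u \near t, h u = pi (k u) /\
    differentiable k u /\ {for u, continuous (derive1 k)}.
  by apply: filterS3 hk dk ck.
exists k, r; split => // u ur.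
- by move=> ui; rewrite gh ?in_itv//; have [] := rP u ur.
- move=> /andP[u1 u2]; have [_ [du _]] := rP u ur.
  rewrite (@velocity_near g h).
    apply: velocity_lift; first exact: differentiable_continuous.
    apply/nearRP; exists (r - `|t - u|); first by rewrite subr_gt0.
    move=> v uv; have [] // := rP v.
    have -> : t - v = (t - u) + (u - v) by rewrite addrA subrK.
    by rewrite (le_lt_trans (ler_normD _ _))// -ltrBrDl.
  apply/nearRP; exists (Num.min (u - T i) (T i.+1 - u)).
    by rewrite lt_min !subr_gt0 u1.
  move=> v; rewrite lt_min !ltr_norml => /andP[/andP[v1 v2] /andP[v3 v4]].
  by apply: gh; rewrite in_itv/=; apply/andP; split; lra.
- by have [_ []] := rP u ur.
- by have [_ []] := rP u ur.
Qed.

Local Notation speed := (fun t => N (velocity g t)).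

(** The speed is continuous on the open intervals of the partition, and nothing is
    known about it at the finitely many break points. *)
Lemma speed_measurable : measurable_fun (`[0, 1]%classic : set R) speed.
Proof.
pose D : set R := \bigcup_(i in [set i | (i < size s)%N]) `]T i, T i.+1[%classic.
have Do : open D by apply: bigcup_open => i _; exact: interval_open.
apply: (@measurable_funS _ _ _ _ (D `|` [set` 0 :: s])).
- by apply: measurableU; [exact: open_measurable | have [] := measurable_fun_seq (0 :: s) speed].
- move=> t /=; rewrite in_itv/= => /andP[t0 t1].
  have [t1'|t_lt1] := leP 1 t.
    have -> : t = 1 by apply/eqP; rewrite eq_le t1 t1'.
    by right; case: sP => _ /eqP <-; rewrite mem_last.
  have [|i si /andP[ti ti1]] := itv_partition_right sP (t := t); first by rewrite t0.
  have [tiE|tin] := eqVneq (T i) t.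
    by right; rewrite -tiE mem_nth// ltnS ltnW.
  by left; exists i => //=; rewrite in_itv/= ti1 andbT lt_neqAle tin.
apply/measurable_funU; first exact: open_measurable.
  by have [] := measurable_fun_seq (0 :: s) speed.
split; last by have [] := measurable_fun_seq (0 :: s) speed.
apply: open_continuous_measurable_fun => // t; rewrite inE => -[i /= si].
rewrite in_itv/= => /andP[t1 t2].
have [|k [r [r0 _ vk _ ck]]] := @piecewise_lift i t si; first by rewrite !ltW.
have kc : {for t, continuous (derive1 k)} by apply: ck; rewrite subrr normr0.
have Nkc : {for t, continuous (N \o derive1 k)}.
  by apply: continuous_comp; [exact: kc | exact: stable_norm_continuous].
have nearE : \forall u \near t, N (derive1 k u) = speed u.
  apply/nearRP; exists (Num.min r (Num.min (t - T i) (T i.+1 - t))).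
    by rewrite !lt_min r0 !subr_gt0 t1.
  move=> u; rewrite !lt_min => /andP[ur /andP[]]; rewrite !ltr_norml.
  by move=> /andP[u1 u2] /andP[u3 u4]; rewrite vk//; apply/andP; split; lra.
exact: near_eq_continuous nearE Nkc.
Qed.

Let speed_ge0 u : 0 <= speed u.
Proof. exact: stable_norm_ge0 qF _. Qed.

Let I (t : R) : \bar R := (\int[lebesgue_measure]_(u in `[0%R, t]) (speed u)%:E)%E.

Let speed_mE (i : interval R) : [set` i] `<=` `[0, 1]%classic ->
  measurable_fun ([set` i] : set R) (EFin \o speed).
Proof.
move=> i01; apply/measurable_EFinP; apply: measurable_funS speed_measurable => //.
Qed.

Let I_le (t t' : R) : t <= t' <= 1 -> (I t <= I t')%E.
Proof.
move=> /andP[tt' t1]; apply: ge0_subset_integral => //.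
- by apply: speed_mE => u /=; rewrite !in_itv/= => /andP[-> /le_trans ->].
- by move=> u _; rewrite lee_fin.
- by move=> u /=; rewrite !in_itv/= => /andP[-> /le_trans ->].
Qed.

Let I_step (t t' c : R) : 0 <= t -> t < t' <= 1 ->
  (forall u, t < u <= t' -> c <= speed u) -> (I t + (c * (t' - t))%:E <= I t')%E.
Proof.
move=> t0 /andP[tt' t1] cu.
have E : `[0, t']%classic = `[0, t]%classic `|` `]t, t']%classic :> set R.
  by rewrite -itv_bndbnd_setU// bnd_simp// ltW.
rewrite {2}/I E ge0_integral_setU//=; last 3 first.
- rewrite -E; apply: speed_mE => u /=; rewrite !in_itv/= => /andP[-> /le_trans ->//].
- by move=> u _; rewrite lee_fin.
- rewrite disj_set2E; apply/eqP/seteqP; split => // u /= [].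
  by rewrite !in_itv/= => /andP[_ ut] /andP[]; rewrite ltNge ut.
apply: leeD => //.
apply: (@le_trans _ _ (\int[lebesgue_measure]_(u in `]t, t']) (Num.max 0 c)%:E)%E).
  rewrite integral_cst//= lebesgue_measure_itv/= lte_fin tt' -EFinD -EFinM lee_fin.
  by apply: ler_wpM2r; [rewrite subr_ge0 ltW | rewrite le_max lexx orbT].
apply: ge0_le_integral => //.
- by move=> u _; rewrite lee_fin le_max lexx.
- apply: speed_mE => u /=; rewrite !in_itv/= => /andP[tu ut'].
  by rewrite (le_trans t0 (ltW tu)) (le_trans ut').
- by move=> u /=; rewrite in_itv/= => tut'; rewrite lee_fin ge_max speed_ge0 cu.
Qed.

(** Real induction on [t] for the inequality between the distance from [g 0] to
    [g t] and the length on [0, t] plus [e * t].  To the right of [t], a lift of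
    the curve moves at first order by its derivative, whose norm is continuous, and
    [q] is at most its stable norm.  At [t] itself, the left continuity of the curve
    suffices, as lengths increase. *)
Lemma finsler_length_ge :
  ((mdist (g 0 : torus qF) (g 1 : torus qF))%:E <= @finsler_length R d A c0 N g)%E.
Proof.
have C0 := flat_gt0 qF.
rewrite -[leRHS]/(I 1); apply/lee_addgt0Pr => e e0; rewrite -(mulr1 e).
pose P (t : R) := ((mdist (g 0 : torus qF) (g t : torus qF))%:E <= I t + (e * t)%:E)%E.
apply: (@real_induction R P); rewrite /P.
- rewrite mdistxx mulr0 adde0; apply: integral_ge0 => u _; rewrite lee_fin; exact: speed_ge0.
- move=> t /andP[t0 t1] Pt.
  have [|i si /andP[ti ti1]] := itv_partition_right sP (t := t); first by rewrite t0.
  have [|k [r [r0 gk vk dk ck]]] := @piecewise_lift i t si; first by rewrite ti ltW.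
  have e2 : 0 < e / 2 by rewrite divr_gt0.
  have tt : `|t - t| < r by rewrite subrr normr0.
  have [r1 r10 kt] := stable_norm_increment e2 (dk t tt).
  have Nkc : {for t, continuous (N \o derive1 k)}.
    by apply: continuous_comp; [exact: ck | exact: stable_norm_continuous].
  have /nearRP[r2 r20 Nk] := continuous_eps Nkc e2.
  exists (Num.min r (Num.min r1 (Num.min r2 (Num.min (T i.+1 - t) (1 - t))))).
    by rewrite !lt_min r0 r10 r20 !subr_gt0 ti1 t1.
  move=> t' /andP[tt']; rewrite -ltrBlDl !lt_min => /andP[tr /andP[tr1 /andP[tr2 /andP[tT t'1]]]].
  have step : (I t + ((N (derive1 k t) - e / 2) * (t' - t))%:E <= I t')%E.
    apply: I_step => //; first by rewrite tt'/=; lra.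
    move=> u /andP[tu ut'].
    have tuE : `|t - u| = u - t by rewrite ler0_norm ?opprB// subr_le0 ltW.
    rewrite vk; [|by rewrite tuE; lra|by apply/andP; split; lra].
    have : `|N (derive1 k t) - N (derive1 k u)| < e / 2 by apply: Nk; rewrite tuE; lra.
    by move=> /ltr_distlBl/ltW.
  have dist : mdist (g t : torus qF) (g t' : torus qF) <= (t' - t) * (N (derive1 k t) + e / 2).
    have tt'E : `|t - t'| = t' - t by rewrite ler0_norm ?opprB// subr_le0 ltW.
    have gtE : g t = pi (k t) by apply: gk => //; rewrite ti ltW.
    rewrite gtE gk; [|by rewrite tt'E|by apply/andP; split; lra].
    rewrite torus_mdist (le_trans (flat_le_stable qF _))// -opprB (stable_normN qF) kt//.
    by rewrite tt'/=; lra.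
  apply: (@le_trans _ _ ((mdist (g 0 : torus qF) (g t : torus qF))%:E +
      ((t' - t) * (N (derive1 k t) + e / 2))%:E)%E).
    by rewrite -EFinD lee_fin (le_trans (metric_triangle _ (g t) _))// lerD2l.
  apply: (@le_trans _ _ (I t + (e * t)%:E + ((t' - t) * (N (derive1 k t) + e / 2))%:E)%E).
    exact: leeD.
  apply: le_trans (leeD step (lexx (e * t')%:E)).
  apply: leeD_EFin.
  by move: (N (derive1 k t)) => a; lra.
- move=> t /andP[t0 t1] Plt; apply/lee_addgt0Pr => eta eta0.
  have [|i si /andP[ti ti1]] := itv_partition_left sP (t := t); first by rewrite t0.
  have [|k [r [r0 gk _ dk _]]] := @piecewise_lift i t si; first by rewrite ti1 ltW.
  have tt : `|t - t| < r by rewrite subrr normr0.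
  have etaC : 0 < eta / C by rewrite divr_gt0.
  have /nearRP[r1 r10 kt] := continuous_eps (differentiable_continuous (dk t tt)) etaC.
  pose r2 := Num.min r (Num.min r1 (Num.min (t - T i) t)).
  have r20 : 0 < r2 by rewrite !lt_min r0 r10 subr_gt0 ti t0.
  have : r2 <= r2 by []; rewrite {2}/r2 !le_min => /andP[rr /andP[rr1 /andP[rT rt]]].
  pose t' := t - r2 / 2.
  have tt' : `|t - t'| = r2 / 2 by rewrite /t' subKr gtr0_norm// divr_gt0.
  have dist : mdist (g t' : torus qF) (g t : torus qF) <= eta.
    rewrite gk; [|by rewrite tt'; lra|by rewrite /t'; apply/andP; split; lra].
    have gtE : g t = pi (k t) by apply: gk => //; rewrite ti1 ltW.
    rewrite gtE (le_trans (torus_pi_lip _ _ _))// mulrC -ler_pdivlMr//.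
    by rewrite distrC ltW// kt// tt'; lra.
  have Pt' := Plt t'; have /Pt' {}Pt' : 0 <= t' < t by rewrite /t'; apply/andP; split; lra.
  apply: (@le_trans _ _ ((mdist (g 0 : torus qF) (g t' : torus qF))%:E + eta%:E)%E).
    by rewrite -EFinD lee_fin (le_trans (metric_triangle _ (g t') _))// lerD2l.
  apply: leeD => //; apply: le_trans Pt' _; apply: leeD.
    by apply: I_le; rewrite t1 andbT /t'; lra.
  by rewrite lee_fin ler_pM2l// /t'; lra.
Qed.

End LowerBound.

(** The image of a segment of direction [u] has constant velocity [u]. *)
Lemma finsler_dist_line (x : A) (u : 'rV[R]_d) :
  (@finsler_dist R d A c0 N x (x + pi u)%R <= (N u)%:E)%E.
Proof.
pose a := torus_val (x : torus qF); have xE : x = pi a by rewrite /a torus_piK.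
pose g (t : R) : A := pi (a + t *: u).
pose L := fun t : R^o => t *: u : 'rV[R]_d.
have Ll : linear L by move=> k s t; rewrite /L scalerDl scalerA.
pose Lin : {linear R^o -> 'rV[R]_d} := HB.pack L (GRing.isLinear.Build _ _ _ _ _ Ll).
have Lc : continuous Lin by exact: scalel_continuous.
have gc : continuous g.
  move=> t; apply: continuous_comp; last exact: torus_pi_continuous.
  by apply: cvgD; [exact: cvg_cst | exact: scalel_continuous].
have gsm t : smooth_curve_at g t.
  split; first exact: gc.
  move=> _ [b _ <-] /= tb; exists (g @^-1` torus_dom q_def b).
    split=> //; apply: open_comp; last exact: torus_dom_open.
    by move=> s _; exact: gc.
  apply: (affine_smooth Lc) => s /torus_log_near[w wP]; exists (a + w).
  have ac : {for s, continuous (fun s : R^o => a + s *: u)}.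
    by apply: cvgD; [exact: cvg_cst | exact: scalel_continuous].
  have : \forall r \near s, log b (pi (a + r *: u)) = a + r *: u + w := ac _ wP.
  apply: filterS => r rw; rewrite [LHS]rw.
  by rewrite addrAC addrC addrA.
apply: (@ereal_inf_lbound); exists g.
  split; [|by rewrite /g scale0r addr0|by rewrite /g scale1r xE -torus_piD].
  exists [:: 1]; first exact: itv_partition1.
  by case=> // _; exists g.
rewrite /finsler_length (eq_integral (cst (N u)%:E)); last first.
  move=> t _ /=; congr (N _)%:E.
  transitivity (velocity g t) => //.
  rewrite (@velocity_lift g (fun s => a + s *: u)); last 2 first.
  - by apply: cvgD; [exact: cvg_cst | exact: scalel_continuous].
  - by near=> s.
  rewrite derive1E (@affine_derive _ _ _ _ Lin a _ _ Lc _).2//; first exact: scale1r.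
  by near=> s; rewrite addrC.
rewrite integral_cst//= lebesgue_measure_itv/= lte_fin ltr01 -EFinD subr0.
by rewrite -EFinM mulr1.
Unshelve. all: by end_near. Qed.

(** Segments show that the Finsler distance is at most the infimum of the stable
    norms of the representatives, which is the quotient distance by [flat_inf]. *)
Theorem torus_finsler (x y : A) :
  @finsler_dist R d A c0 N x y = (mdist (x : torus qF) (y : torus qF))%:E.
Proof.
apply/eqP; rewrite eq_le; apply/andP; split; last first.
  apply: le_ereal_inf_tmp => _ [g [[s sP gP] g0 g1] <-].
  by rewrite -g0 -g1; exact: (finsler_length_ge sP gP).
apply/lee_addgt0Pr => e e0.
set dxy := mdist _ _.
have d0 : 0 <= dxy by exact: mdist_ge0.
pose v := torus_val (y : torus qF) - torus_val (x : torus qF).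
have qv : q v = dxy by rewrite /dxy metric_sym.
have e1 : 0 < e / (dxy + 1) by rewrite divr_gt0// ltr_wpDl.
have [u vu Nu] := flat_inf qF v e1.
have -> : y = x + pi u.
  have : pi (torus_val (y : torus qF)) = pi (torus_val (x : torus qF) + u).
    by apply/torus_piP; rewrite opprD addrA.
  by rewrite torus_piD !torus_piK.
apply: le_trans (finsler_dist_line x u) _; rewrite -EFinD lee_fin (le_trans Nu)//.
rewrite qv mulrDl mul1r lerD2l mulrAC ler_pdivrMr ?ltr_wpDl//.
by rewrite ler_pM2l// lerDl.
Qed.

End FinslerTorus.

(** * Uniqueness of Gromov-Hausdorff limits *)

Section UniqueLimits.
Context (R : realType).

(** A diagonal choice: at rank [n], take a point which is good for the best of the
    precisions [1 / k], [k <= n], that can be attained. *)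
Lemma near_choice (X : nat -> Type) (o : forall n, X n) (P : forall n, R -> X n -> Prop) :
  (forall n (e e' : R) x, e <= e' -> P n e x -> P n e' x) ->
  (forall e : R, 0 < e -> \forall n \near \oo, exists x, P n e x) ->
  exists x : forall n, X n, forall e : R, 0 < e -> \forall n \near \oo, P n e (x n).
Proof.
move=> Pmono Pnear.
have best n : exists x, forall k, (k < n)%N ->
    (exists x', P n k.+1%:R^-1 x') -> P n k.+1%:R^-1 x.
  suff : forall j, exists x, forall k, (k < j)%N ->
    (exists x', P n k.+1%:R^-1 x') -> P n k.+1%:R^-1 x by exact.
  elim=> [|j [x xP]]; first by exists (o n).
  have [[x' x'P]|nx] := pselect (exists x', P n j.+1%:R^-1 x').
    exists x' => k kj _; apply: Pmono x'P.
    by rewrite lef_pV2 ?posrE// ler_nat.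
  exists x => k; rewrite ltnS leq_eqVlt => /orP[/eqP -> //|]; exact: xP.
have /dep_choice[x xP] := best.
exists x => e e0.
pose k := Num.truncn e^-1.
have ke : k.+1%:R^-1 <= e.
  rewrite -[leRHS]invrK lef_pV2 ?posrE ?invr_gt0//.
  have e1 : 0 <= e^-1 by rewrite invr_ge0 ltW.
  by have /andP[_ /ltW] := truncn_itv e1.
near=> n; apply: Pmono ke _; apply: xP.
  by near: n; exact: nbhs_infty_gt.
by near: n; apply: Pnear; rewrite invr_gt0.
Unshelve. all: by end_near. Qed.

Lemma mdist_perturb (M : metricType R) (a b a' b' : M) :
  `|mdist a b - mdist a' b'| <= mdist a a' + mdist b b'.
Proof.
have := metric_triangle a a' b; have := metric_triangle a' b' b.
have := metric_triangle a' a b'; have := metric_triangle a b b'.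
rewrite (metric_sym a' a) (metric_sym b' b) ler_norml => *.
by apply/andP; split; lra.
Qed.

Lemma mdist_cvg (M : metricType R) (F : set_system nat) {FF : Filter F}
  (f : nat -> M) (l : M) (e : R) : f @ F --> l -> 0 < e ->
  \forall n \near F, mdist l (f n) <= e.
Proof. by move=> fl e0; exact: metricType_numDomainType.cvgr_dist_le. Qed.

Section CompactLimits.
Context (Y : nat -> metricType R) (o : forall n, Y n) (A : forall n, set (Y n)).
Arguments A : clear implicits.

(** Since the diameters are bounded, the multiplicative errors are additive ones. *)
Lemma GH_cvg_near (Z : metricType R) (B : set Z) : GH_cvg_compact A B ->
  exists2 phi : forall n, Y n -> Z, (forall n x, A n x -> B (phi n x)) &
    forall e : R, 0 < e -> \forall n \near \oo,
      (forall z, B z -> exists2 x, A n x & mdist z (phi n x) <= e) /\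
      (forall x y, A n x -> A n y ->
        `|mdist (phi n x) (phi n y) - mdist x y| <= e).
Proof.
move=> [_ _ [M AM] [phi [phiB phiP]]]; exists phi => // e e0.
have M1 : 0 < `|M| + 1 by rewrite ltr_wpDl.
have e1 : 0 < e / (`|M| + 1) by rewrite divr_gt0.
have e1e : e / (`|M| + 1) <= e by rewrite ler_pdivrMr// ler_peMr ?(ltW e0)// lerDr.
near=> n.
have [dens dist] : (forall z, B z -> exists2 x, A n x & mdist z (phi n x) <= e / (`|M| + 1)) /\
    (forall x y, A n x -> A n y ->
       (1 - e / (`|M| + 1)) * mdist x y - e / (`|M| + 1) <= mdist (phi n x) (phi n y)
              <= (1 + e / (`|M| + 1)) * mdist x y + e / (`|M| + 1)).
  by near: n; exact: phiP.
split=> [z /dens[x Ax zx]|x y Ax Ay]; first by exists x => //; exact: le_trans zx e1e.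
have xy : mdist x y <= `|M| by exact: le_trans (AM n x y Ax Ay) (ler_norm _).
have h : e / (`|M| + 1) * mdist x y + e / (`|M| + 1) <= e.
  rewrite -{2}(mulr1 (e / (`|M| + 1))) -mulrDr -[leRHS](divfK (lt0r_neq0 M1)).
  by rewrite ler_pM2l// lerD2r.
have /andP[h1 h2] := dist x y Ax Ay.
by rewrite ler_norml; apply/andP; split; lra.
Unshelve. all: by end_near. Qed.

(** Gromov-Hausdorff limits of compact spaces are unique: a point of [B] is
    approximated by points of the [A n], whose images in [B'] converge along an
    ultrafilter. *)
Lemma GH_compact_unique (Z Z' : metricType R) (B : set Z) (B' : set Z') (z0' : Z') :
  GH_cvg_compact A B -> GH_cvg_compact A B' ->
  exists J : Z -> Z', [/\ forall b, B b -> B' (J b),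
    forall b c, B b -> B c -> mdist (J b) (J c) = mdist b c &
    forall b', B' b' -> exists2 b, B b & J b = b'].
Proof.
move=> cB cB'.
have [_ Bc _ _] := cB; have [_ B'c _ _] := cB'.
have [phi phiB phiP] := GH_cvg_near cB.
have [psi psiB psiP] := GH_cvg_near cB'.
have [F [FU Foo]] := ultraFilterLemma (T := nat) (F := \oo) _.
have follow (W : metricType R) (E : set W) (f : forall n, Y n -> W) :
    (forall e : R, 0 < e -> \forall n \near \oo,
      (forall w, E w -> exists2 x, A n x & mdist w (f n x) <= e) /\
      (forall x y, A n x -> A n y -> `|mdist (f n x) (f n y) - mdist x y| <= e)) ->
    forall w, E w -> exists x : forall n, Y n, forall e : R, 0 < e ->
      \forall n \near F, A n (x n) /\ mdist w (f n (x n)) <= e.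
  move=> fP w Ew.
  have [|e e0|x xP] := @near_choice Y o (fun n e x => A n x /\ mdist w (f n x) <= e).
  - by move=> n e e' x ee' [Ax wx]; split => //; exact: le_trans wx ee'.
  - by apply: filterS (fP e e0) => n [/(_ w Ew)[x Ax wx] _]; exists x.
  - by exists x => e e0; apply: Foo; exact: xP.
have phiF e : 0 < e -> \forall n \near F, forall x y, A n x -> A n y ->
    `|mdist (phi n x) (phi n y) - mdist x y| <= e.
  by move=> e0; apply: Foo; apply: filterS (phiP e e0) => n [].
have psiF e : 0 < e -> \forall n \near F, forall x y, A n x -> A n y ->
    `|mdist (psi n x) (psi n y) - mdist x y| <= e.
  by move=> e0; apply: Foo; apply: filterS (psiP e e0) => n [].
have JE (b : Z) : exists b' : Z', B b -> B' b' /\ exists x : forall n, Y n,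
    forall e : R, 0 < e -> \forall n \near F, [/\ A n (x n),
      mdist b (phi n (x n)) <= e & mdist b' (psi n (x n)) <= e].
  have [Bb|nBb] := pselect (B b); last by exists z0'.
  have [x xP] := follow _ _ _ phiP b Bb.
  have [|b' B'b' xb'] := ultra_cvg FU (f := fun n => psi n (x n)) B'c.
    by apply: filterS (xP 1 ltr01) => n [Ax _]; exact: psiB.
  exists b' => _; split => //; exists x => e e0.
  near=> n.
  have [Ax bx] : A n (x n) /\ mdist b (phi n (x n)) <= e by near: n; exact: xP.
  by split => //; near: n; exact: mdist_cvg xb' e0.
have /dep_choice[J JP] := JE.
have isoJ b c : B b -> B c -> mdist (J b) (J c) = mdist b c.
  move=> /JP[_ [x xP]] /JP[_ [y yP]]; apply/eqP; rewrite -subr_eq0 -normr_le0.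
  apply/ler_addgt0Pr => e e0; rewrite add0r.
  have e6 : 0 < e / 6 by rewrite divr_gt0.
  have [n [[Ax bx b'x] [[Ay cy c'y] [ph ps]]]] := filter_ex (filterI (xP _ e6)
    (filterI (yP _ e6) (filterI (phiF _ e6) (psiF _ e6)))).
  have := mdist_perturb (J b) (J c) (psi n (x n)) (psi n (y n)).
  have := mdist_perturb b c (phi n (x n)) (phi n (y n)).
  have := ph _ _ Ax Ay; have := ps _ _ Ax Ay.
  rewrite !ler_norml => /andP[? ?] /andP[? ?] /andP[? ?] /andP[? ?].
  by apply/andP; split; lra.
exists J; split => // [b /JP[]//|b' B'b'].
have [x xP] := follow _ _ _ psiP b' B'b'.
have [|b Bb xb] := ultra_cvg FU (f := fun n => phi n (x n)) Bc.
  by apply: filterS (xP 1 ltr01) => n [Ax _]; exact: phiB.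
exists b => //; have [_ [y yP]] := JP b Bb.
apply: mdist_positivity; apply/eqP; rewrite eq_le mdist_ge0 andbT.
apply/ler_addgt0Pr => e e0; rewrite add0r.
have e6 : 0 < e / 6 by rewrite divr_gt0.
have [n [[Ax b'x] [bx [[Ay by_ b'y] [ph ps]]]]] := filter_ex (filterI (xP _ e6)
  (filterI (mdist_cvg xb e6) (filterI (yP _ e6) (filterI (phiF _ e6) (psiF _ e6))))).
have := ph _ _ Ax Ay; have := ps _ _ Ax Ay.
have := metric_triangle (J b) (psi n (y n)) b'.
have := metric_triangle (psi n (y n)) (psi n (x n)) b'.
have := metric_triangle (phi n (x n)) b (phi n (y n)).
rewrite (metric_sym (psi n (x n)) b') (metric_sym (phi n (x n)) b).
rewrite (metric_sym (psi n (y n)) (psi n (x n))) (metric_sym _ b').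
rewrite !ler_norml => ? ? ? /andP[? ?] /andP[? ?]; lra.
Unshelve. all: by end_near. Qed.

End CompactLimits.
End UniqueLimits.

Section PointedLimits.
Context (R : realType) (d : nat) (q : 'rV[R]_d -> R) (C : R) (qF : flat q C).
Local Notation W := (torus qF).

(** An isometry between compact balls sends the centre to a point [c] whose ball of
    the same radius contains the whole ball, and this point may differ from 0 when
    the space is bounded.  Then the translation by [- c] stabilizes the ball, and
    so does the translation by [c]: it is a limit of translations by multiples of
    [- c], because some positive multiple of [c] is arbitrarily close to 0. *)
Lemma torus_center (r : R) (c : W) : compact (mball (0 : W) r) -> 0 <= r ->
  (forall x : W, mdist (0 : W) x <= r -> mdist c x <= r) ->
  forall x : W, mdist (0 : W) x <= r -> mdist (0 : W) (x + c) <= r.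
Proof.
move=> Bc r0 cP.
have sub (x : W) n : mdist (0 : W) x <= r -> mdist (0 : W) (x - c *+ n) <= r.
  move=> xr; elim: n => [|n IHn]; first by rewrite mulr0n subr0.
  rewrite mulrSr opprD addrA -(torus_mdistB _ _ (- c)) opprK add0r subrK.
  exact: cP.
have recur (e : R) : 0 < e -> exists n, mdist (0 : W) (c *+ n.+1) <= e.
  move=> e0.
  have [F [FU Foo]] := ultraFilterLemma (T := nat) (F := \oo) _.
  have [|l _ cl] := ultra_cvg FU (f := fun n => - (c *+ n)) Bc.
    apply: Foo; near=> n; have := @sub 0 n; rewrite sub0r mdistxx; exact.
  have e2 : 0 < e / 2 by rewrite divr_gt0.
  have Fl : \forall n \near F, mdist (l : W) (- (c *+ n)) <= e / 2.
    exact: (@mdist_cvg R W F _ _ _ _ cl e2).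
  have [i li] := filter_ex Fl.
  have Fi : \forall n \near F, (i < n)%N by apply: Foo; exact: nbhs_infty_gt.
  have [j [lj ij]] := filter_ex (filterI Fl Fi).
  exists (j - i.+1)%N; rewrite -subSn// subSS.
  rewrite mulrnBr; last exact: ltnW.
  have -> : mdist (0 : W) (c *+ j - c *+ i) = mdist (- (c *+ j)) (- (c *+ i)).
    by rewrite -[RHS](torus_mdistDl _ _ (c *+ j)) subrr.
  have := metric_triangle (- (c *+ j)) (l : W) (- (c *+ i)).
  rewrite (metric_sym _ l); lra.
move=> x xr; apply/ler_addgt0Pr => e /recur[n ne].
have := metric_triangle (0 : W) (x - c *+ n) (x + c).
have -> : mdist (x - c *+ n) (x + c) = mdist (0 : W) (c *+ n.+1).
  rewrite -(torus_mdistB (x - c *+ n) _ (x - c *+ n)) subrr opprB.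
  by rewrite [x + c]addrC addrACA subrr addr0 -mulrS.
have := sub x n xr; lra.
Unshelve. all: by end_near. Qed.

(** The isometries between the balls of radius [n], once they respect the base points,
    send each point to a bounded sequence, which converges along an ultrafilter. *)
Lemma GH_cvg_torus_unique (Y : nat -> metricType R) (o : forall n, Y n)
    (Z : metricType R) (z : Z) : GH_cvg o z -> GH_cvg o (0 : W) ->
  exists2 f : Z -> W, bijective f & forall x y, mdist (f x) (f y) = mdist x y.
Proof.
move=> cZ cW.
have ZP n : (0 : R) < n.+1%:R by rewrite ltr0n.
(* translating by the image of [z], which is a centre of the ball, makes the
   isometry between the balls respect the base points *)
have /dep_choice[J JP] : forall n : nat, exists J : Z -> W, [/\
    J z = 0, forall x y, mdist z x <= n.+1%:R -> mdist z y <= n.+1%:R ->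
      mdist (J x) (J y) = mdist x y &
    forall w, mdist (0 : W) w <= n.+1%:R -> exists2 x, mdist z x <= n.+1%:R & J x = w].
  move=> n; have [J [JB Jiso Jonto]] := GH_compact_unique o (0 : W) (cZ _ (ZP n)) (cW _ (ZP n)).
  have zz : mdist z z <= n.+1%:R by rewrite mdistxx ler0n.
  have cP (w : W) : mdist (0 : W) w <= n.+1%:R -> mdist (J z) w <= n.+1%:R.
    by move=> /Jonto[x xn <-]; rewrite Jiso.
  exists (fun x => J x - J z); split.
  - by rewrite subrr.
  - by move=> x y xn yn; rewrite torus_mdistB Jiso.
  - move=> w wn; have [_ Wc _ _] := cW _ (ZP n).
    have [x xn Jx] := Jonto _ (torus_center Wc (ltW (ZP n)) cP wn).
    by exists x => //; rewrite Jx addrK.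
have [F [FU Foo]] := ultraFilterLemma (T := nat) (F := \oo) _.
have large (a : R) : \forall n \near F, a <= n.+1%:R.
  apply: Foo; near=> n; apply: (@le_trans _ _ n%:R); last by rewrite ler_nat.
  by near: n; exact: nbhs_infty_ger.
have fE (x : Z) : exists w : W, J ^~ x @ F --> w.
  have zx : 0 < mdist z x + 1 by rewrite ltr_wpDl// mdist_ge0.
  have [_ Wc _ _] := cW _ zx.
  have [|w _ xw] := ultra_cvg FU (f := J ^~ x) Wc; last by exists w.
  apply: filterS (large (mdist z x)) => n xn; have [Jz Jiso _] := JP n.
  by rewrite /mball/= -Jz Jiso ?mdistxx// lerDl.
have /dep_choice[f fP] := fE.
have fiso x y : mdist (f x) (f y) = mdist x y.
  apply/eqP; rewrite -subr_eq0 -normr_le0.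
  apply/ler_addgt0Pr => e e0; rewrite add0r; have e2 : 0 < e / 2 by rewrite divr_gt0.
  have [n [xn [yn [fx fy]]]] := filter_ex (filterI (large (mdist z x))
    (filterI (large (mdist z y)) (filterI (mdist_cvg (fP x) e2) (mdist_cvg (fP y) e2)))).
  have [_ Jiso _] := JP n.
  have := mdist_perturb (f x) (f y) (J n x) (J n y); rewrite Jiso//= in fx fy *; lra.
have finj : injective f.
  by move=> x y fxy; apply: mdist_positivity; rewrite -fiso fxy mdistxx.
have fsurj w : exists x, f x = w.
  pose r := mdist (0 : W) w.
  have /dep_choice[x xP] : forall n, exists x : Z, r <= n.+1%:R ->
      mdist z x = r /\ J n x = w.
    move=> n; have [rn|_] := leP r n.+1%:R; last by exists z.
    have [Jz Jiso Jonto] := JP n; have [x xn Jx] := Jonto w rn.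
    exists x => _; split => //.
    by rewrite -Jiso ?mdistxx// Jz Jx.
  have r1 : 0 < r + 1 by rewrite ltr_wpDl// mdist_ge0.
  have [_ Zc _ _] := cZ _ r1.
  have [|y _ xy] := ultra_cvg FU (f := x) Zc.
    by apply: filterS (large r) => n rn; have [zx _] := xP n rn; rewrite /mball/= zx lerDl.
  exists y; apply: mdist_positivity; apply/eqP; rewrite eq_le mdist_ge0 andbT.
  apply/ler_addgt0Pr => e e0; rewrite add0r; have e2 : 0 < e / 2 by rewrite divr_gt0.
  have [n [rn [yn [fy xyn]]]] := filter_ex (filterI (large r)
    (filterI (large (mdist z y)) (filterI (mdist_cvg (fP y) e2) (mdist_cvg xy e2)))).
  have [zx Jx] := xP n rn; have [_ Jiso _] := JP n.
  have := metric_triangle (f y) (J n y) w; rewrite -{2}Jx Jiso ?zx//= in fy xyn *; lra.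
have /dep_choice[g gP] := fsurj.
by exists f => //; exists g => // x; apply: finj; rewrite gP.
Unshelve. all: by end_near. Qed.

End PointedLimits.

(** * Convergence of Cayley graphs to a torus *)

Section TorusBalls.
Context (R : realType) (d : nat) (q : 'rV[R]_d -> R) (C : R) (qF : flat q C).
Local Notation W := (torus qF).

Lemma torus_ball_compact (r : R) : compact (mball (0 : W) r).
Proof.
have C0 := flat_gt0 qF.
have qc : continuous q.
  by apply: (lipschitz_norm_continuous C0) => u v; exact: flat_lip qF u v.
have -> : mball (0 : W) r = torus_pi qF @` ([set v | `|v| <= C * r] `&` [set v | q v <= r]).
  apply/seteqP; split => [x|_ [v [_ /= vr] <-]]; last by rewrite /mball/= torus_mdist0.
  elim/(@torus_ind _ _ _ _ qF): x => v; rewrite /mball/= torus_mdist0 => vr.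
  have [w vw wC] := flat_rep qF v.
  exists w; last by apply/torus_piP; rewrite (flatBC qF).
  split => /=; last by rewrite -(flat_eq qF vw).
  by rewrite (le_trans wC)// ler_pM2l.
apply: continuous_compact.
  by apply: continuous_subspaceT; exact: torus_pi_continuous.
apply: compact_closedI; first exact: compact_norm_le.
apply: (@closed_comp _ _ q [set x : R | x <= r]); last exact: closed_le.
by move=> v _; exact: qc.
Qed.

(** Tori are length spaces, so that a point slightly outside of a ball is close to
    the ball: go back along a segment which is almost geodesic. *)
Lemma torus_retract (r : R) (x : W) : 0 <= r -> exists y : W,
  mdist (0 : W) y <= r /\ mdist x y <= 2 * Num.max 0 (mdist (0 : W) x - r).
Proof.
move=> r0; have [xr|rx] := leP (mdist (0 : W) x) r.
  by exists x; rewrite mdistxx mulr_ge0// le_max lexx.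
elim/(@torus_ind _ _ _ _ qF): x rx => v; rewrite torus_mdist0 => rv.
have qv0 : 0 < q v by exact: le_lt_trans rv.
have e0 : 0 < (q v - r) / q v by rewrite divr_gt0// subr_gt0.
have [u vu Nu] := flat_inf qF v e0.
rewrite mulrDl mul1r divfK ?gt_eqF// in Nu.
have uq : q v <= stable_norm q u.
  by rewrite (flat_eq qF vu); exact: flat_le_stable qF u.
have N0 : 0 < stable_norm q u by exact: lt_le_trans uq.
have s1 : r / stable_norm q u <= 1 by rewrite ler_pdivrMr// mul1r (le_trans (ltW rv)).
have s0 : 0 <= r / stable_norm q u by rewrite divr_ge0// ltW.
exists (torus_pi qF ((r / stable_norm q u) *: u)); split.
  rewrite torus_mdist0 (le_trans (flat_le_stable qF _))// (stable_normZ qF).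
  by rewrite ger0_norm// divfK ?gt_eqF.
have -> : torus_pi qF v = torus_pi qF u by exact/torus_piP.
rewrite torus_mdist (le_trans (flat_le_stable qF _))//.
rewrite -{1}(scale1r u) -scalerBl (stable_normZ qF) ger0_norm ?subr_ge0//.
rewrite mulrBl mul1r divfK ?gt_eqF//.
have : q v - r <= Num.max 0 (q v - r) by rewrite le_max lexx orbT.
lra.
Qed.

End TorusBalls.

Section Convergence.
Context (R : realType) (G : nat -> abelianCayleyGraph) (k : nat -> nat)
  (m : nat -> {posnum R}) (K : nat) (x : forall i, 'I_K -> G i).
Local Notation mr := (fun i => (m i)%:num).
Hypotheses (k_gt0 : forall i, (0 < k i)%N)
  (x4 : forall i j, (wlen (x i j) <= 4 * k i)%N)
  (xcov : forall i (y : G i), (wlen y <= 4 * k i)%N ->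
     exists j, (wlen (y - x i j) <= 2 * k i)%N)
  (mesh0 : mesh k mr @ \oo --> (0 : R)).
Context (p : 'rV[R]_K -> R) (p_cvg : plen_cvg k mr x p).
Context (d : nat) (T : 'M[R]_(K, d)) (I : 'M[R]_(d, K)) (q : 'rV[R]_d -> R) (C : R).
Hypotheses (IT : I *m T = 1%:M) (pT : forall v, p v = q (v *m T)) (qF : flat q C).
Local Notation W := (torus qF).
Local Notation pi := (torus_pi qF).

Let m_gt0 i : 0 < mr i.
Proof. by change (0 < (m i)%:num). Qed.

Let rescaled_mdist i (g h : rescaled (m i) (G i)) :
  mdist g h = rlen mr ((h : G i) - (g : G i)).
Proof. by rewrite /mdist/= /rescaled_dist word_distE. Qed.

Lemma rescaled_ball_compact i (r : R) :
  compact (mball ((0 : G i) : rescaled (m i) (G i)) r).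
Proof.
apply: finite_compact; pose n := Num.truncn (r * mr i).
apply: (@sub_finite_set _ _ [set` wball (G i) n]); last exact: finite_fset.
move=> g; rewrite /mball/= rescaled_mdist subr0 /rlen ler_pdivrMr// => gr.
by rewrite -wlen_le /n truncn_ge_nat// (le_trans _ gr)// ler0n.
Qed.

Let near_mesh_le (e : R) : 0 < e -> \forall n \near \oo, mesh k mr n <= e.
Proof. by move=> e0; apply: cvgr_le mesh0 _ _. Qed.

(** A group element [g] is sent to the class of a parameter [v n g] of size at most its
    length.  The parameter of a difference is the difference of the parameters, up
    to the mesh, so that the uniform convergence of lengths makes these maps almost
    isometric.  Their values may fall slightly outside of the ball of radius [r]
    and are then moved back into it. *)
Theorem GH_cvg_torus :
  GH_cvg (fun i => (0 : G i) : rescaled (m i) (G i)) (0 : W).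
Proof.
have C0 := flat_gt0 qF.
have [cI cI0 Ib] := mulmx_bounded I.
move=> r r0; split.
- by move=> n; exact: rescaled_ball_compact.
- exact: torus_ball_compact.
- exists (r + r) => n g h gr hr; apply: le_trans (metric_triangle _ ((0 : G n) : rescaled (m n) (G n)) _) _.
  by rewrite lerD// metric_sym.
have /dep_choice[v vP] : forall n, exists v : G n -> 'rV[R]_K, forall g,
    `|v g| <= rlen mr g /\ rlen mr (g - comb k mr x n (v g)) <= 2 * mesh k mr n.
  move=> n; apply: (@dep_choice (G n) (fun=> 'rV[R]_K) (fun g v =>
    `|v| <= rlen mr g /\ rlen mr (g - comb k mr x n v) <= 2 * mesh k mr n)) => g.
  exact: comb_cover.
have /dep_choice[retr retrP] := fun y : W => torus_retract y (ltW r0).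
pose f n (g : rescaled (m n) (G n)) : W := pi (v n g *m T).
pose phi n (g : rescaled (m n) (G n)) : W := retr (f n g).
exists phi; split; first by move=> n g _; have [] := retrP (f n g).
move=> e e0.
have v0 n : v n 0 = 0.
  have [] := vP n 0; rewrite /rlen wlen0 mul0r normr_le0 => /eqP ->//.
have f0 n : f n (0 : G n) = 0 by rewrite /f v0 mul0mx torus_pi0.
have fE n g h : mdist (f n g) (f n h) = p (v n g - v n h).
  by rewrite torus_mdist pT mulmxBl.
(* [g - h] differs from the combination of parameter [v g - v h] by two covering
   errors and one rounding error *)
pose M : R := 4 * K%:R + 4; have M0 : 0 < M by rewrite ltr_wpDl// mulr_ge0.
have dist n g h : `|rlen mr (h - g) - plen k mr x n (v n g - v n h)| <= M * mesh k mr n.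
  have [_ eg] := vP n g; have [_ eh] := vP n h.
  have := combB k_gt0 m_gt0 x4 n (v n g) (v n h).
  set cg := comb _ _ _ _ (v n g) in eg *; set ch := comb _ _ _ _ (v n h) in eh *.
  set c := comb _ _ _ _ (_ - _) => ec.
  have := rlenB_le (m := mr) m_gt0 (g - h) c; have := rlenB_le (m := mr) m_gt0 c (g - h).
  have E : g - h - c = (g - cg) - (h - ch) - (c - (cg - ch)).
    have -> : (g - cg) - (h - ch) = (g - h) - (cg - ch).
      by rewrite !opprD !opprK addrACA.
    by rewrite [- (c - _)]opprB addrA subrK.
  have := rlenD (m := mr) m_gt0 ((g - cg) - (h - ch)) (- (c - (cg - ch))).
  have := rlenD (m := mr) m_gt0 (g - cg) (- (h - ch)).
  rewrite -E !rlenN [rlen mr (c - (g - h))]rlenBC [rlen mr (h - g)]rlenBC.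
  rewrite /plen -/c ler_norml /M => *; apply/andP; split; lra.
have e8 : 0 < e / 8 by rewrite divr_gt0.
pose eta := Num.min (e / 8) (r / 2).
have eta0 : 0 < eta by rewrite lt_min e8 divr_gt0.
pose B := cI * (C * r) + r.
have meshM' : \forall n \near \oo, M * mesh k mr n <= eta / 4.
  have e4 : 0 < eta / 4 / M by rewrite !divr_gt0.
  by apply: filterS (near_mesh_le e4) => n; rewrite ler_pdivlMr// mulrC.
near=> n.
have meshM : M * mesh k mr n <= eta / 4 by near: n.
have unif w : `|w| <= B + r -> `|plen k mr x n w - p w| <= eta / 4.
  by move: w; near: n; apply: p_cvg; rewrite divr_gt0.
have mesh1 := mesh_gt0 k_gt0 m_gt0 n.
have Brr : r + r <= B + r by rewrite lerD2r lerDr mulr_ge0 ?(ltW cI0)// mulr_ge0// ltW.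
have fdist g h : rlen mr g <= r -> rlen mr h <= r ->
    `|rlen mr (h - g) - mdist (f n g) (f n h)| <= eta / 2.
  move=> gr hr; rewrite fE.
  have [vg _] := vP n g; have [vh _] := vP n h.
  have := dist n g h; have : `|plen k mr x n (v n g - v n h) - p (v n g - v n h)| <= eta / 4.
    by apply: unif; rewrite (le_trans (ler_normB _ _))// (le_trans _ Brr)// lerD// (le_trans vg, le_trans vh).
  rewrite !ler_norml => /andP[? ?] /andP[? ?]; apply/andP; split; lra.
have phif g : rlen mr g <= r -> mdist (f n g) (phi n g) <= eta.
  move=> gr; have [_ h] := retrP (f n g); apply: le_trans h _.
  have : mdist (0 : W) (f n g) - r <= eta / 2.
    have := fdist 0 g; rewrite /rlen wlen0 mul0r ltW// subr0 f0 => /(_ isT gr).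
    by rewrite -/(rlen mr g) ler_norml => /andP[] *; lra.
  have : Num.max 0 (mdist (0 : W) (f n g) - r) <= eta / 2 -> 2 * Num.max 0 (mdist (0 : W) (f n g) - r) <= eta by lra.
  by move=> /[swap] h; apply; rewrite ge_max h andbT; rewrite divr_ge0// ltW.
have etae : eta <= e / 8 by rewrite ge_min lexx.
have etar : eta <= r / 2 by rewrite ge_min lexx orbT.
split=> [z zr|g h].
  (* slightly inside the ball, so that the approximating group element has length
     at most [r] *)
  have r1 : 0 <= r - eta by lra.
  have [y [yr zy]] := torus_retract z r1.
  have {}zy : mdist z y <= 2 * eta.
    apply: le_trans zy _; rewrite ler_pM2l// ge_max (ltW eta0)/=.
    by move: zr; rewrite /mball/=; lra.
  elim/(@torus_ind _ _ _ _ qF): y yr zy => u.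
  have [w uw wC] := flat_rep qF u.
  have -> : pi u = pi w by exact/torus_piP.
  rewrite torus_mdist0 => wr zw.
  pose a := w *m I; have aT : a *m T = w by rewrite /a -mulmxA IT mulmx1.
  have aB : `|a| <= cI * (C * r).
    rewrite (le_trans (Ib w))// ler_pM2l// (le_trans wC)// ler_pM2l//.
    by rewrite (flat_eq qF uw); lra.
  pose g : G n := comb k mr x n a.
  have pa : p a = q w by rewrite pT aT.
  have gr : rlen mr g <= r.
    have : `|plen k mr x n a - p a| <= eta / 4.
      by apply: unif; rewrite (le_trans aB)// /B -addrA lerDl addr_ge0// ltW.
    by rewrite pa ler_norml /plen -/g => /andP[] *; lra.
  exists (g : rescaled (m n) (G n)); first by rewrite /mball/= rescaled_mdist subr0.
  have wf : mdist (pi w) (f n g) <= eta.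
    rewrite /f torus_mdist -aT -mulmxBl -pT.
    have [vg eg] := vP n g.
    have : `|plen k mr x n (a - v n g) - p (a - v n g)| <= eta / 4.
      apply: unif; rewrite (le_trans (ler_normB _ _))//.
      by rewrite /B -addrA lerD// (le_trans vg)// (le_trans gr)// lerDl ltW.
    have := combB k_gt0 m_gt0 x4 n a (v n g).
    have := rlenB_le (m := mr) m_gt0 (comb k mr x n (a - v n g)) (g - comb k mr x n (v n g)).
    rewrite -/g /plen ler_norml => ? ? /andP[] *.
    move: meshM; rewrite /M => meshM; lra.
  have := metric_triangle z (pi w) (phi n g).
  have := metric_triangle (pi w) (f n g) (phi n g).
  have := phif g gr; lra.
rewrite /mball/= !rescaled_mdist !subr0 => gr hr.
have := fdist g h gr hr; have := mdist_perturb (f n g) (f n h) (phi n g) (phi n h).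
have := phif g gr; have := phif h hr.
have l0 : 0 <= e * rlen mr ((h : G n) - (g : G n)) by rewrite mulr_ge0 ?rlen_ge0// ltW.
rewrite !ler_norml mulrBl mulrDl mul1r => ? ? /andP[? ?] /andP[? ?].
apply/andP; split; lra.
Unshelve. all: by end_near. Qed.

End Convergence.

(** * Sequences of abelian Cayley graphs *)

Lemma near_cvg0 (R : realType) (f : nat -> R) : (forall i, 0 <= f i) ->
  (forall e : R, 0 < e -> \forall i \near \oo, f i <= e) -> f @ \oo --> (0 : R).
Proof.
move=> f0 fe; apply/cvgrPdist_le => e e0; apply: filterS (fe e e0) => i fi.
by rewrite sub0r normrN ger0_norm.
Qed.

Lemma GH_cvg_subseq (R : realType) (X : nat -> metricType R) (o : forall n, X n)
    (Z : metricType R) (z : Z) (v : nat -> nat) : {homo v : i j / (i < j)%N} ->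
  GH_cvg o z -> GH_cvg (fun n => o (v n)) z.
Proof.
move=> vI oz r r0; have [Xc Zc [M XM] [phi [phiB phiP]]] := oz r r0.
split => //; first by exists M => n; exact: XM.
exists (fun n => phi (v n)); split => [n|e e0]; first exact: phiB.
exact: near_subseq vI (phiP e e0).
Qed.

(** The growth between [k i] and [5 * k i] bounds the number of generators needed at
    the scale [k i], hence the dimension of the parameter space; the growth between
    [k i] and all [j * k i] then bounds the dimension of the limit. *)
Lemma torus_limit (R : realType) (G : nat -> abelianCayleyGraph) (k : nat -> nat)
    (m : nat -> {posnum R}) (D : R) : (forall i, (0 < k i)%N) ->
    mesh k (fun i => (m i)%:num) @ \oo --> (0 : R) ->
    (forall j, (0 < j)%N -> \forall i \near \oo,
      #|` wball (G i) (j * k i)|%:R <= j%:R `^ D * #|` wball (G i) (k i)|%:R :> R) ->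
  exists2 v : nat -> nat, {homo v : i j / (i < j)%N} &
    exists d (q : 'rV[R]_d -> R) (C : R) (qF : flat q C),
      [/\ forall u, stable_norm q u = 0 -> u = 0, d%:R <= D &
        GH_cvg (fun i => (0 : G (v i)) : rescaled (m (v i)) (G (v i))) (0 : torus qF)].
Proof.
move=> k0 mesh0 growth.
pose K := (Num.truncn (5%:R `^ D)).+1.
have [i0 _ cov] : \forall i \near \oo,
    (#|` wball (G i) (5 * k i)| <= K * #|` wball (G i) (k i)|)%N.
  apply: filterS (growth 5%N isT) => i gi.
  rewrite -(@ler_nat R) natrM (le_trans gi)// ler_wpM2r//.
  by have /andP[_ /ltW] := truncn_itv (powR_ge0 5%:R D).
pose s i := (i + i0)%N.
have sI : {homo s : i j / (i < j)%N} by move=> i j; rewrite ltn_add2r.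
have /dep_choice[x xP] := fun i => wball_cover (cov (s i) (leq_addl _ _)).
have x4 i := (xP i).1; have xcov i := (xP i).2.
have mI i : 0 < (m (s i))%:num by [].
have meshs : mesh (k \o s) (fun i => (m (s i))%:num) @ \oo --> (0 : R).
  by move=> A /mesh0; exact: (near_subseq sI).
have [p [C [u [pF uI pu]]]] :=
  plen_subsequence (fun i => k0 (s i)) mI x4 xcov meshs.
have [d [T [I [q [C' [IT pT qF q_def]]]]]] := flat_reduce pF.
pose v := s \o u.
have vI : {homo v : i j / (i < j)%N} by move=> i j /uI /sI.
have meshv : mesh (k \o v) (fun i => (m (v i))%:num) @ \oo --> (0 : R).
  by move=> A /mesh0; exact: (near_subseq vI).
exists v => //; exists d, q, C', qF; split => //.
- apply: (dimension_le (fun i => k0 (v i)) (fun i => mI (u i)) (fun i => x4 (u i)) meshv pu IT pT qF q_def).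
  by move=> j j0; exact: near_subseq vI (growth j j0).
- exact: (@GH_cvg_torus R (fun i => G (v i)) (k \o v) (fun i => m (v i)) K
    (fun i => x (u i)) (fun i => k0 (v i)) (fun i => x4 (u i)) (fun i => xcov (u i))
    meshv p pu d T I q C' IT pT qF).
Qed.

Lemma sumset_fset0 (G : zmodType) n (x : G) : x \in sumset fset0 n -> x = 0.
Proof. by case: n => [|n]; [rewrite sumset0 => /eqP | move=> /sumsetS[s [y []]]]. Qed.

Lemma card_wball_growth (R : realType) (G : abelianCayleyGraph) (C D : R) n :
  (0 < n)%N -> 0 <= D -> #|` sumset (gens G) n|%:R <= C * n%:R `^ D * #|` gens G|%:R ->
  #|` wball G n|%:R <= Num.max 1 (2 * C) * n%:R `^ D * #|` wball G 1|%:R.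
Proof.
move=> n0 D0 Cn; set C' := Num.max 1 (2 * C).
have nD : 1 <= n%:R `^ D by rewrite -[leLHS](powRr0 n%:R) ler_powR// ler1n.
have C'1 : 1 <= C' by rewrite le_max lexx.
have C'C : 2 * C <= C' by rewrite le_max lexx orbT.
have CnD : 1 <= C' * n%:R `^ D by exact: mulr_ege1.
have [G0|G0] := eqVneq (gens G) fset0.
  have : (#|` wball G n| <= #|` wball G 1|)%N.
    apply/fsubset_leq_card/fsubsetP => x /wball_sub_sumset[k _].
    by rewrite G0 => /sumset_fset0 ->; exact: wball0.
  rewrite -(@ler_nat R) => /le_trans; apply.
  by rewrite ler_peMl.
apply: (@le_trans _ _ (2 * #|` sumset (gens G) n|%:R)).
  by rewrite -natrM ler_nat; exact: card_wball_sumset.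
apply: (@le_trans _ _ (2 * C * n%:R `^ D * #|` gens G|%:R)).
  by rewrite -!mulrA ler_pM2l// mulrA.
have gb : (#|` gens G| <= #|` wball G 1|)%N.
  apply/fsubset_leq_card/fsubsetP => s sS; apply: sumset_sub_wball.
  by apply/sumsetS; exists s, 0; rewrite sumset0 addr0.
apply: (@le_trans _ _ (C' * n%:R `^ D * #|` gens G|%:R)).
  by rewrite !ler_wpM2r// powR_ge0.
by rewrite ler_wpM2l ?ler_nat// mulr_ge0 ?powR_ge0// (le_trans ler01).
Qed.

(** A power of the scale is bounded by a smaller power of [n], so that the scale
    is sublinear. *)
Lemma sublinear_scale (R : realType) (C D D' e : R) : 0 < e -> 0 < C -> 0 < D' -> D < D' ->
  \forall n \near \oo, forall k : nat,
    k%:R `^ D' <= C * n%:R `^ D -> k%:R <= e * n%:R.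
Proof.
move=> e0 C0 D'0 DD'.
have dl0 : 0 < D' - D by rewrite subr_gt0.
have eD : 0 < e `^ D' by rewrite powR_gt0.
pose B := C / e `^ D'.
near=> n => k kn; rewrite leNgt; apply/negP => en.
have n0 : 0 < n%:R :> R by rewrite ltr0n; near: n; exact: nbhs_infty_gt.
have nB : B `^ (D' - D)^-1 < n%:R by near: n; exact: nbhs_infty_gtr.
have nDD : C / e `^ D' < n%:R `^ (D' - D).
  have : (B `^ (D' - D)^-1) `^ (D' - D) < n%:R `^ (D' - D).
    by apply: gt0_ltr_powR => //; rewrite nnegrE ?powR_ge0 ?ltW.
  by rewrite -powRrM mulVf ?gt_eqF// powRr1// divr_ge0// ltW.
have : (e * n%:R) `^ D' < k%:R `^ D'.
  by apply: gt0_ltr_powR => //; rewrite nnegrE ?mulr_ge0// ltW.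
apply/negP; rewrite -leNgt (le_trans kn)// powRM ?(ltW e0)// ?(ltW n0)//.
move: nDD; rewrite ltr_pdivrMr// powRB ?gt_eqF// => /ltW.
rewrite mulrAC ler_pdivlMr; last exact: powR_gt0.
by rewrite [X in _ <= X]mulrC.
Unshelve. all: by end_near. Qed.

Section AbelianCayleyGraphs.
Context (R : realType) (D : R) (D_gt0 : 0 < D) (G : nat -> abelianCayleyGraph).
Context (C : R) (growth : forall n : nat, (0 < n)%N ->
  #|` sumset (gens (G n)) n|%:R <= C * n%:R `^ D * #|` gens (G n)|%:R).
Context (m : nat -> {posnum R}) (c : R) (c_gt0 : 0 < c)
  (m_ge : forall n : nat, c * n%:R <= (m n)%:num).

(** Choose an exponent strictly above [D], so that the selected scales are sublinear
    and hence negligible with respect to [m], and below the next integer, so that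
    the dimension is still at most [D]. *)
Lemma subsequence_torus (u : nat -> nat) : {homo u : i j / (i < j)%N} ->
  exists2 v : nat -> nat, {homo v : i j / (i < j)%N} &
    exists d (q : 'rV[R]_d -> R) (C : R) (qF : flat q C),
      [/\ forall u, stable_norm q u = 0 -> u = 0, d%:R <= D &
        GH_cvg (fun i => (0 : G (u (v i))) : rescaled (m (u (v i))) (G (u (v i))))
          (0 : torus qF)].
Proof.
move=> uI; pose w i := u i.+1.
have wI : {homo w : i j / (i < j)%N} by move=> i j ij; exact: uI.
have w0 i : (0 < w i)%N by exact: leq_trans (incr_ge uI i.+1).
pose D' := (D + (Num.truncn D).+1%:R) / 2.
have /andP[trD Dtr] := truncn_itv (ltW D_gt0).
have DD' : D < D' by rewrite /D'; lra.
have D'0 : 0 < D' by exact: lt_trans DD'.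
have D'D (d : nat) : d%:R <= D' -> d%:R <= D.
  move=> dD; apply: le_trans trD; rewrite ler_nat -ltnS -(@ltr_nat R).
  by apply: le_lt_trans dD _; rewrite /D'; lra.
pose C' := Num.max 1 (2 * C); have C'0 : 0 < C' by rewrite lt_max ltr01.
have /dep_choice[k kP] : forall i, exists k, [/\ (0 < k <= w i)%N,
    forall j, (0 < j)%N -> (j * k <= w i)%N ->
      #|` wball (G (w i)) (j * k)|%:R <= j%:R `^ D' * #|` wball (G (w i)) k|%:R :> R &
    k%:R `^ D' <= C' * (w i)%:R `^ D].
  move=> i; apply: (@scale_selection R (fun n => #|` wball (G (w i)) n|)) => //.
  - exact: wball_gt0.
  - by move=> a b; exact: card_wball_le.
  - exact: card_wball_growth (w0 i) (ltW D_gt0) (growth (w0 i)).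
have k0 i : (0 < k i)%N by have [/andP[]] := kP i.
have small (e : R) : 0 < e -> \forall i \near \oo, (k i)%:R <= e * (w i)%:R.
  move=> e0; have := near_subseq wI (sublinear_scale e0 C'0 D'0 DD').
  by apply: filterS => i; apply; have [] := kP i.
have mesh0 : mesh k (fun i => (m (w i))%:num) @ \oo --> (0 : R).
  apply: near_cvg0 => [i|e e0]; first by rewrite divr_ge0.
  have ec : 0 < e * c by rewrite mulr_gt0.
  apply: filterS (small _ ec) => i ki; rewrite ler_pdivrMr// (le_trans ki)//.
  by rewrite -mulrA ler_pM2l.
have growthk j : (0 < j)%N -> \forall i \near \oo,
    #|` wball (G (w i)) (j * k i)|%:R <= j%:R `^ D' * #|` wball (G (w i)) (k i)|%:R.
  move=> j0; have j1 : 0 < j%:R^-1 :> R by rewrite invr_gt0 ltr0n.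
  apply: filterS (small _ j1) => i; rewrite mulrC ler_pdivlMr ?ltr0n// => ki.
  have [_ + _] := kP i; apply => //.
  by rewrite -(@ler_nat R) natrM mulrC.
have [v vI [d [q [C1 [qF [q_def /D'D dD cv]]]]]] :=
  @torus_limit R (fun i => G (w i)) k (fun i => m (w i)) D' k0 mesh0 growthk.
exists (fun i => (v i).+1); first by move=> i j /vI.
by exists d, q, C1, qF.
Qed.

End AbelianCayleyGraphs.

Lemma torus_isometric_to_finsler (R : realType) (d : nat) (q : 'rV[R]_d -> R) (C : R)
    (qF : flat q C) (q_def : forall u, stable_norm q u = 0 -> u = 0)
    (Z : metricType R) (f : Z -> torus qF) : bijective f ->
  (forall x y, mdist (f x) (f y) = mdist x y) ->
  isometric_to_finsler (torus_lie qF q_def) Z.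
Proof.
move=> fb fiso; exists (torus_chart qF q_def 0), (stable_norm q); split.
- by exists 0.
- by exists 0; rewrite /= ?subrr ?normr0 ?torus_rad_gt0// torus_pi0.
- by split => // [u v|a u]; [exact: stable_normD qF u v | exact: stable_normZ qF a u].
- by exists f => // x y; rewrite torus_finsler fiso.
Qed.

Local Open Scope fset_scope.
Local Open Scope ring_scope.

Theorem theorem1p5 (R : realType) (D : R) (D_gt0 : 0 < D)
    (G : nat -> abelianCayleyGraph)
    (growth : exists C : R, forall n : nat, (0 < n)%N ->
      #|` sumset (gens (G n)) n|%:R <= C * n%:R `^ D * #|` gens (G n)|%:R)
    (m : nat -> {posnum R})
    (m_ge : exists2 c : R, 0 < c & forall n : nat, c * n%:R <= (m n)%:num) :
  let X : nat -> metricType R := fun n => rescaled (m n) (G n) in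
  let o : forall n, X n := fun n => (0 : G n) in
  GH_relatively_compact o /\
  forall (Z : metricType R) (z : Z), GH_cluster_point o z ->
    exists (d : nat) (A : abelianLieGroup R d),
      [/\ d%:R <= D, connected [set: A] & isometric_to_finsler A Z].
Proof.
move=> X o; have [C gC] := growth; have [c c0 mc] := m_ge.
split => [u uI|Z z [u uI uz]].
  have [v vI [d [q [C1 [qF [_ _ cv]]]]]] := subsequence_torus D_gt0 gC c0 mc uI.
  by exists v => //; exists (torus qF), 0.
have [v vI [d [q [C1 [qF [q_def dD cv]]]]]] := subsequence_torus D_gt0 gC c0 mc uI.
have [f fb fiso] := GH_cvg_torus_unique (GH_cvg_subseq vI uz) cv.
exists d, (torus_lie qF q_def); split => //; first exact: torus_connected.
exact: torus_isometric_to_finsler fb fiso.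
Qed.
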